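(* Let $m:\mathbb N\to\mathbb N$ satisfy $m(n_A)=\omega(\log n_A)$ and let $k=k(n)\in\mathrm{poly}(n)$. Then there exists a family of bipartite $n$-qubit pure states $\{|\psi_{AB,n}\rangle\}_n$, on a bipartition with $n_A=n_B=\frac n2$, such that $$H_{\min}(A^k|B^k)_{|\psi_n\rangle^{\otimes k}}=-k\,(n_A-O(1)),\qquad \overset{c}{H}_{\min}(A^k|B^k)_{|\psi_n\rangle^{\otimes k}}\ge-k\,m(n_A).$$
   Context: $\log$ is base $2$; $n$ ranges over even integers, $A$ and $B$ consist of $n_A$ and $n_B$ qubits. $f=\omega(g)$ means $f/g\to\infty$; $O(1)$ denotes a quantity bounded uniformly in $n$. The conditional min-entropy is $H_{\min}(A|B)_\rho:=-\inf_{\sigma_B\ge0,\mathrm{Tr}\sigma_B=1}\log\inf\{\lambda\ge0:\rho_{AB}\le\lambda\,\mathbb 1_A\otimes\sigma_B\}$ (positive semidefinite order). Computational version: fix a finite gate set $\mathcal G$ (each gate is a unitary acting on a bounded number of registers) and a polynomial $p$; these are fixed before the family of states is chosen. For systems $A,B$, $d_A=\dim\mathcal H_A$, $A'\cong A$, $|\Omega_{AA'}\rangle=\frac1{\sqrt{d_A}}\sum_x|x\rangle_A|x\rangle_{A'}$. For a CPTP map $T:\mathcal B(\mathcal H_B)\to\mathcal B(\mathcal H_{A'})$ with adjoint $T^*$, the gate complexity $C(T)$ is the minimal number of gates from $\mathcal G$ in a unitary circuit $U:\mathcal H_B\otimes\mathcal H_E\to\mathcal H_{A'}\otimes\mathcal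 H_K$ (for some ancillary systems $E,K$ of matching total dimension) such that $T(\rho)=\mathrm{tr}_K[U(\rho\otimes|0\rangle\langle0|_E)U^*]$. The Choi operator is $J(T^* ):=d_A(\mathrm{Id}_A\otimes T^* )(|\Omega_{AA'}\rangle\langle\Omega_{AA'}|)$. Let $\mathbf J:=\{J(T^* ):C(T)\le p(n)\}$ and $\mathcal C^E:=\mathrm{cone}(\mathbf J)$ (smallest convex cone), with the standing assumption $\mathrm{span}_{\mathbb R}\mathbf J=\{X\text{ Hermitian on }AB:\mathrm{tr}_AX\in\mathbb R\mathbb 1_B\}$. Write $X\le_SY$ iff $\mathrm{Tr}[XF]\le\mathrm{Tr}[YF]$ for all $F\in\mathcal C^E$. Then $$\overset{c}{D}{}^{A|B}_{\max}(\rho\|\sigma):=\inf\{\lambda\in\mathbb R:\rho\le_S2^\lambda\sigma\},\qquad\overset{c}{H}_{\min}(A|B)_\rho:=-\inf_{\sigma_B\ge0,\mathrm{Tr}\sigma_B=1}\overset{c}{D}{}^{A|B}_{\max}(\rho_{AB}\|\mathbb 1_A\otimes\sigma_B);$$ equivalently $\overset{c}{H}_{\min}(A|B)_\rho=-\log\bigl(d_A\max_{T:C(T)\le p(n)}\langle\Omega_{AA'}|(\mathrm{Id}_A\otimes T)(\rho_{AB})|\Omega_{AA'}\rangle\bigr)$. The quantities with $A^k,B^k$ are these definitions applied to $k$ copies of the systems and the state $|\psi_n\rangle\langle\psi_n|^{\otimes k}$, with channels $T:B^k\to A'^k$ satisfying $C(T)\le p(n)$. *)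

(* Defs.v *)
From HB Require Import structures.
From mathcomp Require Import all_boot all_order all_algebra.
From mathcomp Require Import all_classical all_reals all_analysis.
From mathcomp.real_closed Require Import complex.

Set Implicit Arguments.
Unset Strict Implicit.
Unset Printing Implicit Defensive.

Import Order.TTheory GRing.Theory Num.Theory.
Import numFieldNormedType.Exports.

Local Open Scope classical_set_scope.
Local Open Scope complex_scope.
Local Open Scope sesquilinear_scope.
Local Open Scope ring_scope.

(* A Hilbert space is given by a finite type of basis labels: C^I has basis I, *)
(* and the label type of a tensor product is the product of the label types.  *)
Notation vec R I := 'cV[R[i]]_#|{: I}|.
Notation op R I J := 'M[R[i]]_(#|{: I}|, #|{: J}|).

Definition mkop (R : realType) (I J : finType) (F : I -> J -> R[i]) : op R I J :=
  \matrix_(a, b) F (enum_val a) (enum_val b).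

Definition entry (R : realType) (I J : finType) (A : op R I J) (x : I) (y : J) :
  R[i] := A (enum_rank x) (enum_rank y).

Definition mkvec (R : realType) (I : finType) (F : I -> R[i]) : vec R I :=
  \col_a F (enum_val a).

Definition amp (R : realType) (I : finType) (v : vec R I) (x : I) : R[i] :=
  v (enum_rank x) 0.

Definition projector (R : realType) (I : finType) (v : vec R I) : op R I I :=
  v *m v ^t*.

Definition unit_vec (R : realType) (I : finType) (v : vec R I) : Prop :=
  \tr (v ^t* *m v) = 1.

Definition tens (R : realType) (I I' J J' : finType)
    (A : op R I I') (B : op R J J') : op R (I * J)%type (I' * J')%type :=
  mkop (fun u v => entry A u.1 v.1 * entry B u.2 v.2).

Definition ptrace1 (R : realType) (I J : finType)
    (X : op R (I * J)%type (I * J)%type) : op R J J :=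
  mkop (fun y y' => \sum_(x : I) entry X (x, y) (x, y')).

Definition ptrace2 (R : realType) (I J : finType)
    (X : op R (I * J)%type (I * J)%type) : op R I I :=
  mkop (fun x x' => \sum_(y : J) entry X (x, y) (x', y)).

(* In R[i], 0 <= z means that z is real and nonnegative; hence psd operators   *)
(* are Hermitian.                                                              *)
Definition psd (R : realType) n (A : 'M[R[i]]_n) : Prop :=
  forall v : 'cV[R[i]]_n, 0 <= (v ^t* *m A *m v) 0 0.

Definition lowner (R : realType) n (A B : 'M[R[i]]_n) : Prop := psd (B - A).

Definition densities (R : realType) (I : finType) : set (op R I I) :=
  [set s | psd s /\ \tr s = 1].
Arguments densities R I _ : clear implicits.

Definition log2 (R : realType) (x : R) : R := ln x / ln 2.

(* log2e 0 = -oo and log2e +oo = +oo.                                          *)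
Definition log2e (R : realType) (x : \bar R) : \bar R :=
  (lne x * ((ln 2)^-1)%:E)%E.

Definition Hmin (R : realType) (I J : finType)
    (rho : op R (I * J)%type (I * J)%type) : \bar R :=
  (- ereal_inf [set log2e (ereal_inf [set l%:E | l in
        [set l : R | (0 <= l)%R /\
           lowner rho (l%:C%C *: tens (1%:M : op R I I) sigma)]])
     | sigma in densities R J])%E.

(* Id_I (x) T, acting on each J-block of X.                                    *)
Definition id_tens (R : realType) (I J J' : finType) (T : op R J J -> op R J' J')
    (X : op R (I * J)%type (I * J)%type) : op R (I * J')%type (I * J')%type :=
  mkop (fun u v =>
    entry (T (mkop (fun y y' => entry X (u.1, y) (v.1, y')))) u.2 v.2).

Definition cptp (R : realType) (I J : finType)
    (T : {linear op R I I -> op R J J}) : Prop :=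
  (forall X, \tr (T X) = \tr X) /\
  (forall (r : nat) (X : op R ('I_r * I)%type ('I_r * I)%type),
     psd X -> psd (id_tens T X)).

(* The Hilbert-Schmidt adjoint: tr ((T X)^* Y) = tr (X^* (T^* Y)).             *)
Definition adjoint (R : realType) (I J : finType) (T : op R I I -> op R J J)
    (Y : op R J J) : op R I I :=
  \matrix_(a, b) \tr ((T (delta_mx a b)) ^t* *m Y).

Definition Omega (R : realType) (I : finType) : vec R (I * I)%type :=
  mkvec (fun u => (u.1 == u.2)%:R / sqrtC #|I|%:R).

(* J(T^* ), for T : B(H_J) -> B(H_I) with H_I in the role of A' = A.           *)
Definition choi (R : realType) (I J : finType) (T : op R J J -> op R I I) :
    op R (I * J)%type (I * J)%type :=
  #|I|%:R *: id_tens (adjoint T) (projector (Omega R I)).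

Definition convex_cone (R : realType) n : set (set 'M[R[i]]_n) :=
  [set K | (forall X Y, K X -> K Y -> K (X + Y)) /\
           (forall (a : R) X, 0 <= a -> K X -> K (a%:C%C *: X))].

Definition real_subspace (R : realType) n : set (set 'M[R[i]]_n) :=
  [set K | [/\ K 0, (forall X Y, K X -> K Y -> K (X + Y)) &
             (forall (a : R) X, K X -> K (a%:C%C *: X))]].

Definition cone (R : realType) n (S : set 'M[R[i]]_n) : set 'M[R[i]]_n :=
  smallest (@convex_cone R n) S.

Definition real_span (R : realType) n (S : set 'M[R[i]]_n) : set 'M[R[i]]_n :=
  smallest (@real_subspace R n) S.

(* Basis labels of a system whose qubits are indexed by W.                     *)
Notation bits W := {ffun W -> bool}.

Record gate_set (R : realType) := GateSet {
  gate_name :> finType;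
  arity : gate_name -> nat;
  gate : forall g : gate_name, op R (bits 'I_(arity g)) (bits 'I_(arity g));
  gate_unitary : forall g : gate_name, gate g \is unitarymx
}.

Record placed_gate (R : realType) (G : gate_set R) (W : finType) := PlacedGate {
  pgate : G;
  pwires : {ffun 'I_(arity pgate) -> W};
  pwires_inj : injective pwires
}.

Definition placed_op (R : realType) (G : gate_set R) (W : finType)
    (q : placed_gate G W) : op R (bits W) (bits W) :=
  mkop (fun x y : bits W =>
    if [forall w, (w \notin codom (pwires q)) ==> (x w == y w)]
    then entry (gate (pgate q)) [ffun i => x (pwires q i)] [ffun i => y (pwires q i)]
    else 0).

(* The head of the list is applied first.                                      *)
Fixpoint circuit_op (R : realType) (G : gate_set R) (W : finType)
    (c : seq (placed_gate G W)) : op R (bits W) (bits W) :=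
  if c is q :: c' then circuit_op c' *m placed_op q else 1%:M.

Definition split_bits (W V V' : finType) (f : W -> V + V')
    (u : bits V * bits V') : bits W :=
  [ffun w => match f w with inl a => u.1 a | inr b => u.2 b end].

(* The unitary H_B (x) H_E -> H_A' (x) H_K of a circuit on the qubits of B     *)
(* and E, where the qubit w becomes the qubit out w of A' or K. This assignment *)
(* of the output qubits is not charged as gates.                               *)
Definition circuit_map (R : realType) (G : gate_set R) (A B E K : finType)
    (c : seq (placed_gate G (B + E)%type)) (out : B + E -> A + K) :
    op R (bits A * bits K)%type (bits B * bits E)%type :=
  mkop (fun o i => entry (circuit_op c) (split_bits out o) (split_bits id i)).

Definition ket0 (R : realType) (W : finType) : vec R (bits W) :=
  mkvec (fun x => (x == [ffun=> false])%:R).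

Definition implements (R : realType) (G : gate_set R) (A B E K : finType)
    (c : seq (placed_gate G (B + E)%type)) (out : B + E -> A + K)
    (T : op R (bits B) (bits B) -> op R (bits A) (bits A)) : Prop :=
  forall rho, let U := circuit_map c out in
    T rho = ptrace2 (U *m tens rho (projector (ket0 R E)) *m U ^t*).

(* Equals +oo when no circuit implements T.                                    *)
Definition gate_complexity (R : realType) (G : gate_set R) (A B : finType)
    (T : op R (bits B) (bits B) -> op R (bits A) (bits A)) : \bar R :=
  ereal_inf [set x | exists (e l : nat)
      (c : seq (placed_gate G (B + 'I_e)%type)) (out : B + 'I_e -> A + 'I_l),
    [/\ bijective out, implements c out T & x = (size c)%:R%:E]].

Definition efficient_choi (R : realType) (G : gate_set R) (s : R) (A B : finType) :
    set (op R (bits A * bits B)%type (bits A * bits B)%type) :=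
  [set choi T | T in
    [set T : {linear op R (bits B) (bits B) -> op R (bits A) (bits A)} |
      cptp T /\ (gate_complexity G T <= s%:E)%E]].
Arguments efficient_choi {R} G s A B _.

(* The standing assumption on the gate set G and the gate budget s.            *)
Definition spanning (R : realType) (G : gate_set R) (s : R) (A B : finType) : Prop :=
  real_span (efficient_choi G s A B) =
  [set X | X \is hermsymmx /\ exists r : R, ptrace1 X = (r%:C%C)%:M].

Definition cone_le (R : realType) n (K : set 'M[R[i]]_n) (X Y : 'M[R[i]]_n) : Prop :=
  forall F, K F -> \tr (X *m F) <= \tr (Y *m F).

Definition comp_Dmax (R : realType) (G : gate_set R) (s : R) (A B : finType)
    (rho sigma : op R (bits A * bits B)%type (bits A * bits B)%type) : \bar R :=
  ereal_inf [set l%:E | l in [set l : R |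
    cone_le (cone (efficient_choi G s A B)) rho ((2 `^ l)%:C%C *: sigma)]].

Definition comp_Hmin (R : realType) (G : gate_set R) (s : R) (A B : finType)
    (rho : op R (bits A * bits B)%type (bits A * bits B)%type) : \bar R :=
  (- ereal_inf [set comp_Dmax G s rho (tens (1%:M : op R (bits A) (bits A)) sigma)
     | sigma in densities R (bits B)])%E.

(* psi^{(x) k}, regrouped along the bipartition A^k : B^k; the qubit (j, i) of  *)
(* A^k is the qubit i of the j-th copy of A.                                   *)
Definition copies (R : realType) (k : nat) (A B : finType)
    (psi : vec R (bits A * bits B)%type) :
    vec R (bits ('I_k * A)%type * bits ('I_k * B)%type)%type :=
  mkvec (fun u : bits ('I_k * A)%type * bits ('I_k * B)%type => \prod_(j < k)
    amp psi ([ffun a => u.1 (j, a)], [ffun b => u.2 (j, b)])).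

(* Main.v *)
Require Import Defs.
From mathcomp Require Import all_boot all_order all_algebra.
From mathcomp Require Import all_classical all_reals all_analysis.
From mathcomp.real_closed Require Import complex.
From mathcomp Require Import ring.
Import Order.TTheory GRing.Theory Num.Theory.
Import numFieldNormedType.Exports.

(** The states are |psi_s> = 2^(-n_A/2) \sum_x s_x |x>|x> for a sign pattern s.
    They are maximally entangled, so H_min of k copies is exactly -k n_A.  For a
    channel T the computational quantity is governed by the quadratic form
    Q_T(s) = \sum_(x,y) s^k_x s^k_y <x|T(|x><y|)|y>, where s^k_x is the product of
    the k signs and the coefficients have modulus at most 1.  Averaged over s, a
    monomial survives only if no point of {0,1}^n_A occurs exactly once in it,
    whence E[Q_T^q] <= L^(2L) 2^(n_A L) with L = k q.  Channels of complexity at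
    most p(n) only involve polynomially many wires, so there are at most 2^l of the
    forms Q_T with l polynomial in n; taking q = l, a union bound yields one s with
    Q_T(s) <= 2^(k m) 2^(k n_A) for all of them as soon as 2 (k l)^2 <= 2^m, which
    holds for large n because m = omega(log n_A).  For the finitely many remaining
    n, and when k = 0, the product state |0>|0> does. *)

Set Implicit Arguments.
Unset Strict Implicit.
Unset Printing Implicit Defensive.
Local Open Scope ring_scope.

(** * Moments of random sign forms *)

Lemma leq_exp2r_weak (a b n : nat) : (a <= b)%N -> (a ^ n <= b ^ n)%N.
Proof. by case: n => // n; rewrite leq_exp2r. Qed.

Section RandomSigns.
Variables (K : numFieldType) (X : finType).

Definition sign (s : {ffun X -> bool}) (x : X) : K := (-1) ^+ s x.

Definition no_singleton_fibre (I : finType) (t : {ffun I -> X}) : bool :=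
  [forall i, exists j, (j != i) && (t j == t i)].

(** Flipping the sign at a point hit exactly once by [t] is an involution on sign patterns that
    negates the product, so the sum equals its own opposite. *)
Lemma sum_sign_prod_eq0 (I : finType) (t : {ffun I -> X}) :
  ~~ no_singleton_fibre t ->
  \sum_(s : {ffun X -> bool}) \prod_i sign s (t i) = 0.
Proof.
case/forallPn=> i0 /existsPn tP.
pose flip (s : {ffun X -> bool}) := [ffun x => s x (+) (x == t i0)].
have flipK : involutive flip.
  by move=> s; apply/ffunP=> x; rewrite !ffunE -addbA addbb addbF.
set S := \sum_s _.
have SN : S = - S.
  rewrite [LHS](reindex_inj (inv_inj flipK)) /= /S -sumrN.
  apply: eq_bigr => s _.
  rewrite (bigD1 i0) //= [in RHS](bigD1 i0) //= -mulNr; congr (_ * _).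
    by rewrite /sign ffunE eqxx addbT; case: (s _); rewrite ?expr0 ?expr1 ?opprK.
  apply: eq_bigr => i ii0; rewrite /sign ffunE.
  by have := tP i; rewrite ii0 /= => /negbTE ->; rewrite addbF.
by apply/eqP; move/eqP: SN; rewrite -addr_eq0 -mulr2n mulrn_eq0.
Qed.

Lemma norm_sum_sign_prod (I : finType) (t : {ffun I -> X}) :
  `|\sum_(s : {ffun X -> bool}) \prod_i sign s (t i)| <=
  (no_singleton_fibre t)%:R * (2 ^ #|X|)%:R.
Proof.
have [_|/sum_sign_prod_eq0 ->] := boolP (no_singleton_fibre t); last first.
  by rewrite normr0 mul0r.
rewrite mul1r; apply: (le_trans (ler_norm_sum _ _ _)).
rewrite (eq_bigr (fun=> 1)) => [|s _]; last first.
  by rewrite normr_prod big1 // => i _; rewrite normr_sign.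
by rewrite sumr_const card_ffun card_bool.
Qed.

(* Such a map takes at most L values, so it factors through 'I_L. *)
Lemma card_no_singleton_fibre (x0 : X) (I : finType) (L : nat) :
  #|I| = (2 * L)%N ->
  (#|[set t : {ffun I -> X} | no_singleton_fibre t]| <=
   L ^ (2 * L) * #|X| ^ L)%N.
Proof.
move=> cI.
pose F (p : {ffun I -> 'I_L} * {ffun 'I_L -> X}) := [ffun i => p.2 (p.1 i)].
have -> : (L ^ (2 * L) * #|X| ^ L = #|[set: {ffun I -> 'I_L} * {ffun 'I_L -> X}]|)%N.
  by rewrite cardsT card_prod !card_ffun card_ord cI.
apply: leq_trans (leq_imset_card F _); apply: subset_leq_card.
apply/fintype.subsetP => t; rewrite inE => /forallP tP.
pose T := [set t i | i : I].
(* Every value has a fibre of at least two points, and the fibres partition the $2L$ elements of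
   [I]. *)
have cT : (#|T| <= L)%N.
  rewrite -(leq_pmul2l (ltn0Sn 1)) -cI -[#|I|]sum1_card.
  rewrite (partition_big t [in T]) => [|i _]; last exact: imset_f.
  rewrite mulnC -sum_nat_const; apply: leq_sum => x /imsetP[i _ ->].
  have /existsP[j /andP[ji tji]] := tP i.
  by rewrite (bigD1 i) //= (bigD1 j) /= ?ji ?tji.
have lt_index i : (index (t i) (enum T) < L)%N.
  by apply: leq_trans cT; rewrite cardE index_mem mem_enum imset_f.
(* [x0] only fills positions past the end of [enum T], which no index occurring here reaches. *)
apply/imsetP; exists ([ffun i => Ordinal (lt_index i)],
  [ffun j : 'I_L => nth x0 (enum T) j]); first by rewrite inE.
by apply/ffunP => i; rewrite !ffunE /= nth_index // mem_enum imset_f.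
Qed.

Variables (Y : finType) (k : nat) (pr : Y -> 'I_k -> X).

(** For $k$ copies, [Y] will hold the joint labels and [pr y j] the label of the $j$-th copy, so
    this is the sign $s^k_y$ of a joint amplitude. *)
Definition signs (s : {ffun X -> bool}) (y : Y) : K := \prod_(j < k) sign s (pr y j).

Definition sign_form (M : Y -> Y -> K) (s : {ffun X -> bool}) : K :=
  \sum_y \sum_z signs s y * signs s z * M y z.

Hypothesis pr_inj : forall y z, pr y =1 pr z -> y = z.

(** In the expanded power a monomial is a choice [u] of $q$ index pairs, hence a map [t u] from
    $2kq$ places to [X]. Distinct choices give distinct maps because [pr] separates points, so the
    surviving monomials are no more than the maps without singleton fibre. The factor $2^{|X|}$
    reflects a sum over patterns instead of a mean. *)
Lemma moment_sign_form (x0 : X) (q : nat) (M : Y -> Y -> K) :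
  (forall y z, `|M y z| <= 1) ->
  `|\sum_s sign_form M s ^+ q| <=
    ((k * q) ^ (2 * (k * q)) * #|X| ^ (k * q) * 2 ^ #|X|)%:R.
Proof.
move=> M1; set L := (k * q)%N.
pose I := ('I_q * 'I_k * bool)%type.
pose U := {ffun 'I_q -> Y * Y}.
pose t (u : U) : {ffun I -> X} := [ffun i => pr (if i.2 then (u i.1.1).1 else (u i.1.1).2) i.1.2].
have t_inj : injective t.
  move=> u v /ffunP uv; apply/ffunP => i.
  case Eu: (u i) => [a b]; case Ev: (v i) => [c d].
  congr (_, _); apply: pr_inj => j.
    by have := uv (i, j, true); rewrite !ffunE /= Eu Ev.
  by have := uv (i, j, false); rewrite !ffunE /= Eu Ev.
have -> : \sum_s sign_form M s ^+ q =
    \sum_(u : U) (\prod_i M (u i).1 (u i).2) * \sum_s \prod_i sign s (t u i).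
  under eq_bigr => s _.
    rewrite /sign_form pair_bigA /= -{1}(card_ord q) -prodr_const.
    rewrite bigA_distr_bigA /=.
    over.
  rewrite exchange_big /=; apply: eq_bigr => u _.
  rewrite mulr_sumr; apply: eq_bigr => s _.
  rewrite big_split /= mulrC; congr (_ * _).
  transitivity (\prod_(i < q) \prod_(j < k) \prod_b sign s (t u (i, j, b))); last first.
    by rewrite !pair_bigA /=; apply: eq_bigr => -[[i j] b] _.
  apply: eq_bigr => i _; rewrite /signs -big_split /=.
  by apply: eq_bigr => j _; rewrite big_bool /= !ffunE /=.
apply: (le_trans (ler_norm_sum _ _ _)).
apply: (@le_trans _ _ (\sum_(u : U) (no_singleton_fibre (t u))%:R * (2 ^ #|X|)%:R)).
  apply: ler_sum => u _; rewrite normrM; apply: le_trans (norm_sum_sign_prod (t u)).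
  rewrite ler_piMl // normr_prod; apply: prodr_ile1 => i _.
  by rewrite normr_ge0 M1.
rewrite -mulr_suml natrM ler_pM2r ?ltr0n ?expn_gt0 //.
rewrite -natr_sum ler_nat.
have -> : (\sum_u (no_singleton_fibre (t u) : nat) =
    #|[set u | no_singleton_fibre (t u)]|)%N.
  rewrite -sum1_card [RHS]big_mkcond; apply: eq_bigr => u _.
  by rewrite inE; case: no_singleton_fibre.
rewrite -(card_imset _ t_inj).
apply: leq_trans (@card_no_singleton_fibre x0 I L _); last first.
  by rewrite !card_prod !card_ord card_bool mulnC /L (mulnC k).
apply: subset_leq_card; apply/fintype.subsetP => _ /imsetP[u uP ->].
by move: uP; rewrite !inE.
Qed.

(* Union bound: if every sign pattern were bad for some M_c, the sum over c of
   the q-th moments would exceed the bound of moment_sign_form. *)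
Lemma exists_good_signs (x0 : X) (l w : nat) (C : finType) (P : pred C)
    (M : C -> Y -> Y -> K) :
  (0 < k)%N -> (#|C| < 2 ^ l)%N -> (2 * (k * l) ^ 2 <= 2 ^ w)%N ->
  (forall c, P c -> forall y z, `|M c y z| <= 1) ->
  (forall c, P c -> forall s, 0 <= sign_form (M c) s) ->
  exists s, forall c, P c -> sign_form (M c) s <= (2 ^ (w * k) * #|X| ^ k)%:R.
Proof.
move=> k0 Cl lw M1 M0; set B := (2 ^ (w * k) * #|X| ^ k)%N.
pose good s := [forall c, P c ==> (sign_form (M c) s <= B%:R)].
have [/existsP[s /forall_inP sP]|/existsPn bad] := boolP [exists s, good s].
  by exists s => c /sP.
have X0 : (0 < #|X|)%N by apply/card_gt0P; exists x0.
have B0 : (0 < B)%N by rewrite muln_gt0 !expn_gt0 X0.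
pose q := l.
(* Comparing moments when every pattern is bad gives this inequality, which the bounds on [#|C|] and
   on $kl$ refute. *)
suff : (2 ^ #|X| * B ^ q <= #|C| * ((k * q) ^ (2 * (k * q)) * #|X| ^ (k * q) * 2 ^ #|X|))%N.
  rewrite leqNgt => /negP[]; rewrite /q; set L := (k * l)%N.
  (* For $L=0$ the power is $0^0=1$. *)
  have L2 : (0 < L ^ (2 * L))%N by rewrite expn_gt0; case: (L).
  apply: (@leq_trans (2 ^ l * (L ^ (2 * L) * #|X| ^ L * 2 ^ #|X|))).
    by rewrite ltn_pmul2r // !muln_gt0 L2 !expn_gt0 X0.
  have -> : (B ^ l = 2 ^ (w * L) * #|X| ^ L)%N.
    by rewrite /B expnMn -!expnM -mulnA.
  have lL : (l <= L)%N by rewrite leq_pmull.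
  (* As $l\le L$, the left side is at most $(2L^2)^L\le(2^w)^L$. *)
  have key : (2 ^ l * L ^ (2 * L) <= 2 ^ (w * L))%N.
    move: lw lL; rewrite -/L; clearbody L => lw lL.
    apply: (@leq_trans (2 ^ L * L ^ (2 * L))).
      by rewrite leq_mul2r leq_exp2l // lL orbT.
    rewrite !expnM -expnMn; have [->//|L0] := posnP L.
    by rewrite leq_exp2r.
  by rewrite [leqRHS]mulnCA -mulnA mulnA leq_mul // mulnC.
rewrite -(ler_nat K).
apply: (@le_trans _ _ (\sum_(c | P c) \sum_s sign_form (M c) s ^+ q)).
  rewrite exchange_big /= natrM -[X in (X)%:R * _]/(2 ^ #|X|)%N.
  have -> : (2 ^ #|X| = #|{ffun X -> bool}|)%N by rewrite card_ffun card_bool.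
  rewrite mulr_natl -sumr_const; apply: ler_sum => s _.
  have /forallPn[c] := bad s; rewrite negb_imply => /andP[Pc /negP Bc].
  rewrite (bigD1 c) //= natrX ler_wpDr ?sumr_ge0 // => [i /andP[Pi _]|].
    exact/exprn_ge0/M0.
  apply: lerXn2r; rewrite ?nnegrE ?ler0n ?M0 //.
  (* The order of [K] may be partial; failure of one comparison gives the other only because both
     sides are real. *)
  by have /orP[] := real_leVge (realn _ B) (ger0_real (M0 _ Pc s)).
rewrite natrM mulr_natl -sumr_const [leRHS](bigID P) /= ler_wpDr ?sumr_ge0 //.
apply: ler_sum => c Pc; apply: le_trans (moment_sign_form x0 q (M1 c Pc)).
by rewrite ger0_norm // sumr_ge0 // => s _; rewrite exprn_ge0 // M0.
Qed.

End RandomSigns.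

Local Open Scope classical_set_scope.
Local Open Scope ring_scope.

(** * Channels and their Choi operators *)

Section Entries.
Local Open Scope sesquilinear_scope.
Variable R : realType.
Implicit Types I J L : finType.

Lemma sum_enum_rank (V : nmodType) I (F : 'I_#|{: I}| -> V) :
  \sum_a F a = \sum_(x : I) F (enum_rank x).
Proof. by rewrite (reindex (@enum_rank I)) //=; apply/onW_bij/enum_rank_bij. Qed.

Lemma entry_mkop I J (F : I -> J -> R[i]) x y : entry (mkop F) x y = F x y.
Proof. by rewrite /entry mxE !enum_rankK. Qed.

Lemma amp_mkvec I (F : I -> R[i]) x : amp (mkvec F) x = F x.
Proof. by rewrite /amp mxE enum_rankK. Qed.

Lemma entry_mulmx I J L (A : op R I J) (B : op R J L) x z :
  entry (A *m B) x z = \sum_y entry A x y * entry B y z.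
Proof. by rewrite /entry mxE sum_enum_rank. Qed.

Lemma trace_entry I (A : op R I I) : \tr A = \sum_x entry A x x.
Proof. by rewrite /mxtrace sum_enum_rank. Qed.

Lemma entry_adjoint I J (A : op R I J) x y : entry (A ^t*) x y = (entry A y x)^*.
Proof. by rewrite /entry !mxE. Qed.

Lemma entry_projector I (v : vec R I) x y :
  entry (projector v) x y = amp v x * (amp v y)^*.
Proof. by rewrite /entry mxE big_ord1 !mxE. Qed.

Lemma entry_tens I I' J J' (A : op R I I') (B : op R J J') u v :
  entry (tens A B) u v = entry A u.1 v.1 * entry B u.2 v.2.
Proof. by rewrite entry_mkop. Qed.

Lemma entry_delta I J (x x' : I) (y y' : J) :
  entry (delta_mx (enum_rank x) (enum_rank y) : op R I J) x' y' =
  ((x' == x) && (y' == y))%:R.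
Proof. by rewrite /entry mxE !(inj_eq enum_rank_inj). Qed.

Lemma entry_scalar I (x y : I) : entry (1%:M : op R I I) x y = (x == y)%:R.
Proof. by rewrite /entry mxE (inj_eq enum_rank_inj). Qed.

Lemma entryZ I J a (A : op R I J) x y : entry (a *: A) x y = a * entry A x y.
Proof. by rewrite /entry mxE. Qed.

Lemma quad_form_entry I (A : op R I I) (v : vec R I) :
  (v ^t* *m A *m v) 0 0 = \sum_x \sum_y (amp v x)^* * entry A x y * amp v y.
Proof.
rewrite mxE sum_enum_rank exchange_big /=; apply: eq_bigr => y _.
rewrite mxE sum_enum_rank mulr_suml; apply: eq_bigr => x _.
by rewrite !mxE.
Qed.

Lemma quad_form_projector I (w v : vec R I) :
  (v ^t* *m projector w *m v) 0 0 = `|\sum_x (amp v x)^* * amp w x| ^+ 2.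
Proof.
rewrite normCK rmorph_sum /= mulr_suml quad_form_entry; apply: eq_bigr => x _.
rewrite mulr_sumr; apply: eq_bigr => y _.
by rewrite entry_projector rmorphM /= conjCK -!mulrA [_^* * amp v y]mulrC.
Qed.

Lemma psd_projector I (w : vec R I) : psd (projector w).
Proof. by move=> v; rewrite quad_form_projector exprn_ge0. Qed.

Lemma mkop_delta I (a b : 'I_#|{: I}|) :
  mkop (fun y y' : I => (a == enum_rank y)%:R * ((b == enum_rank y')%:R)^*) =
  delta_mx a b :> op R I I.
Proof.
apply/matrixP=> i j; rewrite !mxE !enum_valK conjC_nat -natrM mulnb.
by rewrite ![_ == a]eq_sym ![_ == b]eq_sym.
Qed.

Lemma op_ext (I J : finType) (A B : op R I J) :
  (forall x y, entry A x y = entry B x y) -> A = B.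
Proof.
by move=> AB; apply/matrixP => i j; have := AB (enum_val i) (enum_val j);
  rewrite /entry !enum_valK.
Qed.

Lemma entry_conjugate_delta (I J : finType) (U : op R J I) (u v : I) (o o' : J) :
  entry (U *m delta_mx (enum_rank u) (enum_rank v) *m U ^t*) o o' =
  entry U o u * (entry U o' v)^*.
Proof.
rewrite entry_mulmx (bigD1 v) //= [X in _ + X]big1 ?addr0 => [|w wv]; last first.
  rewrite entry_mulmx big1 ?mul0r // => z _.
  by rewrite entry_delta (negbTE wv) andbF mulr0.
rewrite entry_adjoint entry_mulmx (bigD1 u) //= [X in _ + X]big1 ?addr0 => [|w wu].
  by rewrite entry_delta !eqxx mulr1.
by rewrite entry_delta (negbTE wu) mulr0.
Qed.

End Entries.

Section Channels.
Local Open Scope sesquilinear_scope.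
Variables (R : realType) (I J : finType).
Variable T : {linear op R J J -> op R I I}.
Hypothesis Tcptp : cptp T.

Definition unit_image (y y' : J) : op R I I :=
  T (delta_mx (enum_rank y) (enum_rank y')).

Lemma entry_adjoint_map (Y : op R I I) y y' :
  entry (adjoint T Y) y y' = \tr ((unit_image y y') ^t* *m Y).
Proof. by rewrite /entry mxE. Qed.

(** The two factors $1/\sqrt d$ of [Omega] cancel the $d$ of [choi], and the conjugate comes from
    the Hilbert-Schmidt adjoint. *)
Lemma entry_choi u v :
  entry (choi T) u v = (entry (unit_image u.2 v.2) u.1 v.1)^*.
Proof.
have I0 : #|I| != 0%N by rewrite -lt0n; apply/card_gt0P; exists u.1.
rewrite entryZ entry_mkop entry_adjoint_map.
rewrite -/(unit_image u.2 v.2) trace_entry (bigD1 v.1) //= [X in _ + X]big1 => [|z zv].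
  rewrite addr0 entry_mulmx (bigD1 u.1) //= [X in _ + X]big1 => [|z zu].
    rewrite addr0 entry_adjoint entry_mkop entry_projector !amp_mkvec /= !eqxx.
    rewrite mulrCA -[RHS]mulr1; congr (_ * _).
    rewrite !mul1r geC0_conj ?invr_ge0 ?sqrtC_ge0 ?ler0n //.
    by rewrite -invfM -expr2 sqrtCK divff // pnatr_eq0.
  rewrite entry_mkop entry_projector !amp_mkvec /= eq_sym (negbTE zu).
  by rewrite mul0r mul0r mulr0.
rewrite entry_mulmx big1 // => w _.
rewrite entry_mkop entry_projector !amp_mkvec /= eq_sym [v.1 == z]eq_sym (negbTE zv).
by rewrite mul0r conjC0 !mulr0.
Qed.

Lemma trace_unit_image y y' : \tr (unit_image y y') = (y == y')%:R.
Proof.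
rewrite /unit_image Tcptp.1 trace_entry (bigD1 y) //= big1 => [|z zy].
  by rewrite addr0 entry_delta eqxx.
by rewrite entry_delta (negbTE zy).
Qed.

(** Complete positivity in coordinates: $T$ acts on half of the unnormalised maximally entangled
    projector [phi], and the result is tested on the vector with amplitudes [c]. The reference
    system in [cptp] is an ordinal, so labels pass through [enum_rank]. *)
Lemma unit_image_psd (c : J -> I -> R[i]) :
  0 <= \sum_x \sum_z \sum_x' \sum_z'
    (c x z)^* * entry (unit_image x x') z z' * c x' z'.
Proof.
pose phi : vec R ('I_#|{: J}| * J)%type := mkvec (fun u => (u.1 == enum_rank u.2)%:R).
have := Tcptp.2 _ _ (psd_projector phi) (mkvec (fun u => c (enum_val u.1) u.2)).
rewrite quad_form_entry.
move=> h; apply: le_trans h _; rewrite le_eqVlt; apply/orP; left; apply/eqP.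
transitivity (\sum_(u : 'I_#|{: J}| * I) \sum_(v : 'I_#|{: J}| * I)
    (c (enum_val u.1) u.2)^* * entry (T (delta_mx u.1 v.1)) u.2 v.2 *
    c (enum_val v.1) v.2).
  apply: eq_bigr => u _; apply: eq_bigr => v _.
  rewrite !amp_mkvec entry_mkop; congr (_ * entry (T _) _ _ * _).
  rewrite -mkop_delta; congr mkop; apply/funext => y; apply/funext => y'.
  by rewrite entry_projector !amp_mkvec.
rewrite -(pair_bigA _ (fun a z => \sum_(v : 'I_#|{: J}| * I)
  (c (enum_val a) z)^* * entry (T (delta_mx a v.1)) z v.2 *
  c (enum_val v.1) v.2)) /=.
rewrite sum_enum_rank; apply: eq_bigr => x _; apply: eq_bigr => z _.
rewrite -(pair_bigA _ (fun a z' => (c (enum_val (enum_rank x)) z)^* *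
  entry (T (delta_mx (enum_rank x) a)) z z' * c (enum_val a) z')) /=.
rewrite sum_enum_rank; apply: eq_bigr => x' _; apply: eq_bigr => z' _.
by rewrite !enum_rankK.
Qed.

End Channels.

(** * Positive semidefinite kernels *)

Section PsdKernel.
Variables (K : numClosedFieldType) (I : finType) (M : I -> I -> K).
Hypothesis M_psd : forall a : I -> K, 0 <= \sum_x \sum_y (a x)^* * M x y * a y.

(** The form is tested on the function with value 1 at [x], [b] at [y] and 0 elsewhere. *)
Lemma psd_kernel_two_points x y (b : K) : x != y ->
  0 <= M x x + b * M x y + b^* * M y x + `|b| ^+ 2 * M y y.
Proof.
move=> xy; have := M_psd (fun z => (z == x)%:R + (z == y)%:R * b).
have only_xy (F : I -> K) : (forall z, z != x -> z != y -> F z = 0) ->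
    \sum_z F z = F x + F y.
  move=> F0; rewrite (bigD1 x) //= (bigD1 y) /=; last by rewrite eq_sym.
  by rewrite big1 ?addr0 // => z /andP[]; apply: F0.
rewrite only_xy => [|z /negbTE zx /negbTE zy]; last first.
  by rewrite big1 // => w _; rewrite zx zy mul0r addr0 conjC0 !mul0r.
rewrite !only_xy => [|z /negbTE zx /negbTE zy|z /negbTE zx /negbTE zy]; last 2 first.
- by rewrite zx zy mul0r addr0 !mulr0.
- by rewrite zx zy mul0r addr0 !mulr0.
rewrite !eqxx (negbTE xy) [y == x]eq_sym (negbTE xy) /= !mul0r !mul1r !addr0 !add0r.
by rewrite conjC1 !mul1r !mulr1 normCKC [M x y * b]mulrC [_ * M y y * b]mulrAC !addrA.
Qed.

Lemma psd_kernel_diag_ge0 z : 0 <= M z z.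
Proof.
have := M_psd (fun w => (w == z)%:R).
rewrite (bigD1 z) //= [X in _ + X]big1 => [|w /negbTE wz]; last first.
  by rewrite big1 // => v _; rewrite wz conjC0 !mul0r.
rewrite (bigD1 z) //= [X in _ + X + _]big1 => [|w /negbTE wz]; last first.
  by rewrite wz mulr0.
by rewrite eqxx conjC1 mul1r mulr1 !addr0.
Qed.

(** The two-point form is real for every phase [b]; the cases $b=1$ and $b=i$ determine [M y x]. *)
Lemma psd_kernel_hermitian x y : x != y -> M y x = (M x y)^*.
Proof.
move=> xy; have form_real (b : K) : `|b| = 1 -> b * M x y + b^* * M y x \is Num.real.
  move=> b1; have /ger0_real := psd_kernel_two_points b xy.
  rewrite b1 expr1n mul1r => h.
  have -> : b * M x y + b^* * M y x =
      M x x + b * M x y + b^* * M y x + M y y - (M x x + M y y) by ring.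
  by rewrite rpredB // rpredD // ger0_real ?psd_kernel_diag_ge0.
have /CrealP := form_real 1 (normr1 _).
have /CrealP := form_real 'i (normCi _).
rewrite !rmorphD !rmorphM /= !conjCK conjCi conjC1 !mul1r => h1 h2.
set p := M x y in h1 h2 *; set r := M y x in h1 h2 *.
have h3 : r^* + r = p + p^*.
  apply: (mulfI (neq0Ci K)); apply/eqP; rewrite -subr_eq0.
  have -> : 'i * (r^* + r) - 'i * (p + p^*) =
    - 'i * p^* + 'i * r^* - ('i * p + - 'i * r) by ring.
  by rewrite h1 subrr.
apply/eqP; rewrite -subr_eq0.
suff: (r - p^*) *+ 2 == 0 by rewrite mulrn_eq0.
have -> : (r - p^*) *+ 2 = (r^* + r - (p + p^*)) - (p^* + r^* - (p + r)) by ring.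
by rewrite h2 h3 !subrr.
Qed.

(** With the phase $b$ chosen so that $bM_{xy}=-|M_{xy}|$, the two-point form yields $2|M_{xy}|\le
    M_{xx}+M_{yy}\le 2$. *)
Lemma psd_kernel_norm_le1 : (forall x, M x x <= 1) -> forall x y, `|M x y| <= 1.
Proof.
move=> M1 x y; have [<-|xy] := eqVneq x y.
  by rewrite ger0_norm // psd_kernel_diag_ge0.
have [->|p0] := eqVneq (M x y) 0; first by rewrite normr0.
pose b := - (M x y)^* / `|M x y|.
have b1 : `|b| = 1.
  by rewrite normrM normrN norm_conjC normfV normr_id divff ?normr_eq0.
have bp : b * M x y = - `|M x y|.
  rewrite /b mulNr mulNr mulrAC -normCKC expr2 mulfK ?normr_eq0 //.
have := psd_kernel_two_points b xy.
rewrite (psd_kernel_hermitian xy) -rmorphM bp rmorphN /= b1 expr1n mul1r.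
rewrite (CrealP (normr_real _)) => h.
rewrite -(ler_pM2r (ltr0n _ 2)) mul1r -subr_ge0.
have -> : 2 - `|M x y| * 2 = (M x x + - `|M x y| - `|M x y| + M y y) +
    ((1 - M x x) + (1 - M y y)) by ring.
by rewrite addr_ge0 // addr_ge0 // subr_ge0.
Qed.
End PsdKernel.

(** * Diagonal states paired with Choi operators *)

Section Overlap.
Local Open Scope sesquilinear_scope.
Variables (R : realType) (I : finType).
Variable T : {linear op R I I -> op R I I}.
Hypothesis Tcptp : cptp T.

Lemma conjC_real (x : R) : (x%:C%C)^* = x%:C%C.
Proof. exact: conjc_real. Qed.

Definition diag_state (b : I -> R) : vec R (I * I)%type :=
  mkvec (fun u => (u.1 == u.2)%:R * (b u.1)%:C%C).

(** This is $\langle x|T(|x\rangle\langle y|)|y\rangle$, all that a state $\sum_x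
    b_x|x\rangle|x\rangle$ detects of $T$. *)
Definition overlap (x y : I) : R[i] := entry (unit_image T x y) x y.

Lemma overlap_psd (a : I -> R[i]) : 0 <= \sum_x \sum_y (a x)^* * overlap x y * a y.
Proof.
have := unit_image_psd Tcptp (fun x z => (x == z)%:R * a x).
move=> h; apply: le_trans h _; rewrite le_eqVlt; apply/orP; left; apply/eqP.
apply: eq_bigr => x _; rewrite (bigD1 x) //= [X in _ + X]big1 ?addr0 => [|z zx]; last first.
  rewrite big1 // => x' _; rewrite big1 // => z' _.
  by rewrite eq_sym (negbTE zx) mul0r conjC0 !mul0r.
apply: eq_bigr => y _; rewrite (bigD1 y) //= [X in _ + X]big1 ?addr0 => [|z zy]; last first.
  by rewrite eq_sym (negbTE zy) mul0r mulr0.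
by rewrite !eqxx !mul1r.
Qed.

(** It is one of the nonnegative diagonal entries of $T(|x\rangle\langle x|)$, whose trace is 1. *)
Lemma overlap_diag_le1 x : overlap x x <= 1.
Proof.
have diag_ge0 z : 0 <= entry (unit_image T x x) z z.
  have := unit_image_psd Tcptp (fun x' z' => ((x' == x) && (z' == z))%:R).
  rewrite (bigD1 x) //= [X in _ + X]big1 ?addr0 => [|w /negbTE wx]; last first.
    rewrite big1 // => z' _; rewrite big1 // => x' _; rewrite big1 // => z'' _.
    by rewrite wx conjC0 !mul0r.
  rewrite (bigD1 z) //= [X in _ + X]big1 ?addr0 => [|w /negbTE wz]; last first.
    by rewrite big1 // => x' _; rewrite big1 // => z'' _; rewrite wz andbF conjC0 !mul0r.
  rewrite (bigD1 x) //= [X in _ + X]big1 ?addr0 => [|w /negbTE wx]; last first.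
    by rewrite big1 // => z' _; rewrite wx mulr0.
  rewrite (bigD1 z) //= [X in _ + X]big1 ?addr0 => [|w /negbTE wz]; last first.
    by rewrite wz andbF mulr0.
  by rewrite !eqxx conjC1 mul1r mulr1.
have <- : \tr (unit_image T x x) = 1 by rewrite trace_unit_image // eqxx.
by rewrite trace_entry (bigD1 x) //= lerDl sumr_ge0.
Qed.

Lemma norm_overlap_le1 x y : `|overlap x y| <= 1.
Proof. exact: psd_kernel_norm_le1 overlap_psd overlap_diag_le1 x y. Qed.

Lemma overlap_real_form_ge0 (b : I -> R) :
  0 <= \sum_x \sum_y (b x * b y)%:C%C * overlap x y.
Proof.
have := overlap_psd (fun x => (b x)%:C%C).
move=> h; apply: le_trans h _; rewrite le_eqVlt; apply/orP; left; apply/eqP.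
apply: eq_bigr => x _; apply: eq_bigr => y _.
rewrite rmorphM /= mulrAC; congr (_ * _ * _).
by rewrite conjC_real.
Qed.

(** Choi entries are conjugated, but the form on the right is real, so it may be replaced by its
    conjugate. *)
Lemma trace_diag_state_choi (b : I -> R) :
  \tr (projector (diag_state b) *m choi T) =
  \sum_x \sum_y (b x * b y)%:C%C * overlap x y.
Proof.
have /ger0_real/CrealP herm := overlap_real_form_ge0 b.
rewrite -herm exchange_big rmorph_sum trace_entry /=.
transitivity (\sum_x \sum_x' \sum_y \sum_y'
    (x == x')%:R * (y == y')%:R * (b x * b y)%:C%C *
    (entry (unit_image T y' x') y x)^*).
  rewrite [RHS]pair_bigA /=; apply: eq_bigr => -[x x'] _ /=.
  rewrite entry_mulmx pair_bigA; apply: eq_bigr => -[y y'] _ /=.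
  rewrite entry_projector !amp_mkvec entry_choi /= rmorphM /= conjC_nat conjC_real.
  have -> : (b x * b y)%:C%C = (b x)%:C%C * (b y)%:C%C by rewrite rmorphM.
  by ring.
rewrite exchange_big /=; apply: eq_bigr => x' _.
rewrite (bigD1 x') //= [X in _ + X]big1 ?addr0 => [|x xx']; last first.
  by rewrite big1 // => y _; rewrite big1 // => y' _; rewrite (negbTE xx') !mul0r.
rewrite rmorph_sum; apply: eq_bigr => y _ /=.
rewrite (bigD1 y) //= [X in _ + X]big1 ?addr0 => [|y' yy']; last first.
  by rewrite eq_sym (negbTE yy') mulr0 !mul0r.
by rewrite !eqxx !mul1r [RHS]rmorphM /= conjC_real (mulrC (b y)).
Qed.

Lemma trace_tens_choi (s : op R I I) :
  \tr (tens (1%:M : op R I I) s *m choi T) = \tr s.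
Proof.
rewrite !trace_entry.
transitivity (\sum_x \sum_y \sum_x' \sum_y'
    (x == x')%:R * entry s y y' *
    (entry (unit_image T y' y) x' x)^*).
  rewrite [RHS]pair_bigA /=; apply: eq_bigr => -[x y] _ /=.
  rewrite entry_mulmx pair_bigA; apply: eq_bigr => -[x' y'] _ /=.
  by rewrite entry_tens entry_scalar entry_choi.
transitivity (\sum_y \sum_y' entry s y y' * (\tr (unit_image T y' y))^*).
  rewrite exchange_big; apply: eq_bigr => y _.
  under eq_bigr => x _ do rewrite exchange_big /=.
  rewrite exchange_big; apply: eq_bigr => y' _.
  rewrite trace_entry rmorph_sum mulr_sumr; apply: eq_bigr => x _ /=.
  rewrite (bigD1 x) //= [X in _ + X]big1 ?addr0 => [|x' xx']; last first.
    by rewrite eq_sym (negbTE xx') !mul0r.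
  by rewrite eqxx mul1r.
apply: eq_bigr => y _; rewrite (bigD1 y) //= [X in _ + X]big1 ?addr0 => [|y' yy'].
  by rewrite trace_unit_image // eqxx conjC1 mulr1.
by rewrite trace_unit_image // (negbTE yy') conjC0 mulr0.
Qed.
End Overlap.

(** * Min-entropies of diagonal states *)

Section CompHmin.
Variable R : realType.

(** The operators [F] satisfying the trace inequality form a convex cone. *)
Lemma cone_le_generators n (S : set 'M[R[i]]_n) (X Y : 'M[R[i]]_n) :
  cone_le S X Y -> cone_le (cone S) X Y.
Proof.
move=> XY F SF; apply: (SF [set F | \tr (X *m F) <= \tr (Y *m F)]).
split=> [|F' SF']; last exact: XY.
split=> [A B /= hA hB|a A a0 /= hA].
  by rewrite !mulmxDr !raddfD /= lerD.
rewrite -!scalemxAr !mxtraceZ ler_wpM2l // lecE /= a0 eqxx //.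
Qed.

(** By [trace_tens_choi] all densities pair to 1 with a Choi operator, so a single choice,
    $|0\rangle\langle 0|$, is enough. *)
Lemma comp_Hmin_ge (G : gate_set R) (s l : R) (A : finType)
    (rho : op R (bits A * bits A)%type (bits A * bits A)%type) :
  (forall T : {linear op R (bits A) (bits A) -> op R (bits A) (bits A)},
     cptp T -> (gate_complexity G T <= s%:E)%E ->
     \tr (rho *m choi T) <= (2 `^ l)%:C%C) ->
  ((- l)%:E <= comp_Hmin G s rho)%E.
Proof.
move=> bound; rewrite /comp_Hmin EFinN leeN2.
pose sigma : op R (bits A) (bits A) := projector (ket0 R A).
have tr_sigma : \tr sigma = 1.
  rewrite trace_entry (bigD1 [ffun=> false]) //= big1 => [|x x0].
    by rewrite entry_projector !amp_mkvec eqxx conjC1 mulr1 addr0.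
  by rewrite entry_projector !amp_mkvec (negbTE x0) mul0r.
apply: ge_ereal_inf; eexists.
  by exists sigma; [split; [exact: psd_projector|exact: tr_sigma]|reflexivity].
apply: ge_ereal_inf; exists l%:E => //; exists l => //=.
apply: cone_le_generators => _ [T [Tcptp Ts] <-].
rewrite -scalemxAl mxtraceZ trace_tens_choi // tr_sigma mulr1.
exact: bound.
Qed.

End CompHmin.

Section QuadraticForms.
Local Open Scope sesquilinear_scope.
Variable R : realType.

Lemma lowner_quad_form n (A B : 'M[R[i]]_n) :
  lowner A B <->
  forall v : 'cV_n, (v ^t* *m A *m v) 0 0 <= (v ^t* *m B *m v) 0 0.
Proof.
have formB v : (v ^t* *m (B - A) *m v) 0 0 =
    (v ^t* *m B *m v) 0 0 - (v ^t* *m A *m v) 0 0.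
  by rewrite mulmxBr mulmxBl mxE; congr (_ + _); rewrite mxE.
by split=> h v; have := h v; rewrite formB subr_ge0.
Qed.

Lemma quad_form_scale n (A : 'M[R[i]]_n) a (v : 'cV_n) :
  (v ^t* *m (a *: A) *m v) 0 0 = a * (v ^t* *m A *m v) 0 0.
Proof. by rewrite -scalemxAr -scalemxAl mxE. Qed.

Lemma quad_form_tens1 (I J : finType) (s : op R J J) (v : vec R (I * J)%type) :
  (v ^t* *m tens (1%:M : op R I I) s *m v) 0 0 =
  \sum_x \sum_y \sum_y' (amp v (x, y))^* * entry s y y' * amp v (x, y').
Proof.
rewrite quad_form_entry [RHS]pair_bigA /=; apply: eq_bigr => -[x y] _ /=.
transitivity (\sum_x' \sum_y' (amp v (x, y))^* *
    entry (tens (1%:M : op R I I) s) (x, y) (x', y') * amp v (x', y')).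
  by rewrite pair_bigA; apply: eq_bigr => -[].
rewrite (bigD1 x) //= [X in _ + X]big1 ?addr0 => [|x' xx']; last first.
  rewrite big1 // => y' _.
  by rewrite entry_tens entry_scalar /= eq_sym (negbTE xx') mul0r mulr0 mul0r.
by apply: eq_bigr => y' _; rewrite entry_tens entry_scalar /= eqxx mul1r.
Qed.

(** Lagrange's identity: twice the difference of the two sides is $\sum_{x,y}w_xw_y(t_x-t_y)^2$. *)
Lemma cauchy_schwarz_weighted (K : numFieldType) (I : finType) (w t : I -> K) :
  (forall x, 0 <= w x) -> (forall x, t x \is Num.real) ->
  (\sum_x w x * t x) ^+ 2 <= (\sum_x w x) * \sum_x w x * t x ^+ 2.
Proof.
move=> w0 tR; rewrite -(ler_pM2l (ltr0n _ 2)) expr2.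
set S := \sum_x w x; set S1 := \sum_x _; set S2 := \sum_x _.
have -> : 2 * (S * S2) = S * S2 + S2 * S by ring.
rewrite /S /S1 /S2 !big_distrlr /= mulr_sumr -big_split /=.
apply: ler_sum => x _; rewrite mulr_sumr -big_split /=.
apply: ler_sum => y _; rewrite -subr_ge0.
have -> : w x * (w y * t y ^+ 2) + w x * t x ^+ 2 * w y -
    2 * (w x * t x * (w y * t y)) = w x * w y * (t x - t y) ^+ 2 by ring.
apply: mulr_ge0; first exact: mulr_ge0.
by rewrite real_exprn_even_ge0 // rpredB.
Qed.

End QuadraticForms.

(** * The min-entropy of a diagonal state is $-2\log\sum_x|b_x|$ *)

Section HminDiag.
Local Open Scope sesquilinear_scope.
Variables (R : realType) (I : finType) (b : I -> R).

Let B := \sum_x `|b x|.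
Hypothesis B_gt0 : 0 < B.

Lemma overlap_diag_state (v : vec R (I * I)%type) :
  \sum_u (amp v u)^* * amp (diag_state b) u =
  \sum_x (amp v (x, x))^* * (b x)%:C%C.
Proof.
transitivity (\sum_x \sum_y (amp v (x, y))^* * amp (diag_state b) (x, y)).
  by rewrite pair_bigA; apply: eq_bigr => -[].
apply: eq_bigr => x _.
rewrite (bigD1 x) //= [X in _ + X]big1 ?addr0 => [|y yx].
  by rewrite amp_mkvec /= eqxx mul1r.
by rewrite amp_mkvec /= eq_sym (negbTE yx) mul0r mulr0.
Qed.

Lemma normC_real (x : R) : `|x%:C%C| = `|x|%:C%C.
Proof. by rewrite normc_def /= expr0n addr0 sqrtr_sqr. Qed.

(** The test vector $\sum_x\mathrm{sgn}(b_x)|x\rangle|x\rangle$ has overlap $B$ with the state,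
    while $1\otimes\sigma$ takes the value $\mathrm{tr}\,\sigma=1$ on it whatever $\sigma$ is. *)
Lemma lowner_diag_state_ge (s : op R I I) (l : R) :
  \tr s = 1 ->
  lowner (projector (diag_state b)) (l%:C%C *: tens (1%:M : op R I I) s) ->
  B ^+ 2 <= l.
Proof.
move=> tr1 /lowner_quad_form h.
pose sg x : R := (-1) ^+ (b x < 0)%R.
have := h (diag_state sg).
rewrite quad_form_projector overlap_diag_state quad_form_scale quad_form_tens1.
have -> : \sum_x (amp (diag_state sg) (x, x))^* * (b x)%:C%C = B%:C%C.
  rewrite /B rmorph_sum; apply: eq_bigr => x _ /=.
  rewrite amp_mkvec /= eqxx mul1r conjC_real -rmorphM; congr (_%:C%C).
  by rewrite /sg [X in _ * X]realEsign ?num_real // mulrA -expr2 sqrr_sign mul1r.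
have -> : \sum_x \sum_y \sum_y' (amp (diag_state sg) (x, y))^* * entry s y y' *
    amp (diag_state sg) (x, y') = 1.
  rewrite -tr1 trace_entry; apply: eq_bigr => x _.
  rewrite (bigD1 x) //= [X in _ + X]big1 ?addr0 => [|y yx]; last first.
    rewrite big1 // => y' _.
    by rewrite amp_mkvec /= eq_sym (negbTE yx) mul0r conjC0 !mul0r.
  rewrite (bigD1 x) //= [X in _ + X]big1 ?addr0 => [|y yx]; last first.
    by rewrite [X in _ * X]amp_mkvec /= eq_sym (negbTE yx) mul0r mulr0.
  rewrite amp_mkvec /= eqxx mul1r conjC_real mulrAC -rmorphM /= /sg -expr2.
  by rewrite sqrr_sign mul1r.
by rewrite mulr1 normC_real -rmorphXn /= lecR real_normK // num_real.
Qed.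

(** Weights proportional to $|b_x|$ are the ones produced by Cauchy-Schwarz with weights $|b_x|$;
    this density attains the infimum in [Hmin]. *)
Definition optimal_marginal : op R I I :=
  mkop (fun y y' => (y == y')%:R * (`|b y| / B)%:C%C).

Lemma optimal_marginal_density : densities R I optimal_marginal.
Proof.
have w0 x : 0 <= (`|b x| / B)%:C%C by rewrite lecR divr_ge0 // ltW.
split=> [v|].
  rewrite quad_form_entry sumr_ge0 // => x _.
  rewrite (bigD1 x) //= [X in _ + X]big1 ?addr0 => [|y yx]; last first.
    by rewrite entry_mkop eq_sym (negbTE yx) mul0r mulr0 mul0r.
  by rewrite entry_mkop eqxx mul1r mulrAC -normCKC mulr_ge0 ?exprn_ge0.
rewrite trace_entry; under eq_bigr => x _ do rewrite entry_mkop eqxx mul1r.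
by rewrite -rmorph_sum -mulr_suml divff // gt_eqF.
Qed.

(** For amplitudes $v_{xy}$, $(\sum_x|b_x||v_{xx}|)^2\le B\sum_x|b_x||v_{xx}|^2$, which is the part
    of the right-hand form carried by the diagonal; the remaining terms are nonnegative. *)
Lemma lowner_diag_state_optimal :
  lowner (projector (diag_state b))
    ((B ^+ 2)%:C%C *: tens (1%:M : op R I I) optimal_marginal).
Proof.
apply/lowner_quad_form => v.
rewrite quad_form_projector overlap_diag_state quad_form_scale quad_form_tens1.
apply: (@le_trans _ _ ((\sum_x `|b x|%:C%C * `|amp v (x, x)|) ^+ 2)).
  rewrite lerXn2r ?nnegrE ?sumr_ge0 // => [x _|].
    by rewrite mulr_ge0 // lecR.
  apply: le_trans (ler_norm_sum _ _ _) _; apply: ler_sum => x _.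
  by rewrite normrM norm_conjC normC_real mulrC.
apply: le_trans (cauchy_schwarz_weighted _ _) _ => [x|x|].
- by rewrite lecR.
- exact: normr_real.
rewrite -rmorph_sum -/B expr2 rmorphM /= -mulrA.
rewrite ler_pM2l ?ltcR // mulr_sumr; apply: ler_sum => x _.
rewrite (bigD1 x) //= mulrDr -[leLHS]addr0 lerD //.
  rewrite (bigD1 x) //= [X in _ + X]big1 ?addr0 => [|y yx]; last first.
    by rewrite entry_mkop eq_sym (negbTE yx) mul0r mulr0 mul0r.
  rewrite entry_mkop eqxx mul1r mulrAC -normCKC [leRHS]mulrCA -[B%:C%C * _]rmorphM /=.
  by rewrite [B * _]mulrC divfK ?gt_eqF // mulrC.
apply: mulr_ge0; first by rewrite lecR ltW.
apply: sumr_ge0 => y yx.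
rewrite (bigD1 y) //= [X in _ + X]big1 ?addr0 => [|z zy]; last first.
  by rewrite entry_mkop eq_sym (negbTE zy) mul0r mulr0 mul0r.
rewrite entry_mkop eqxx mul1r mulrAC -normCKC.
by apply: mulr_ge0; rewrite ?exprn_ge0 // lecR divr_ge0 // ltW.
Qed.

Lemma log2e_fin (x : R) : 0 < x -> log2e x%:E = (log2 x)%:E.
Proof. by move=> x0; rewrite /log2e lne_EFin // -EFinM. Qed.

Lemma le_log2e (x y : \bar R) : (0 <= x)%E -> (x <= y)%E -> (log2e x <= log2e y)%E.
Proof.
move=> x0 xy; have y0 := le_trans x0 xy.
apply: lee_wpmul2r; first by rewrite lee_fin invr_ge0 ln_ge0 // ler1n.
by rewrite lee_lne ?in_itv /= ?x0 ?y0 ?leey //; exact: xy.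
Qed.

Lemma Hmin_diag_state : Hmin (projector (diag_state b)) = (- (2 * log2 B))%:E.
Proof.
have B2 : 0 < B ^+ 2 by rewrite exprn_gt0.
have lB : log2e (B ^+ 2)%:E = (2 * log2 B)%:E.
  by rewrite log2e_fin // /log2 lnXn // mulr_natl mulrnAl.
rewrite /Hmin EFinN; congr (- _)%E; apply/eqP; rewrite eq_le; apply/andP; split.
  rewrite -lB; apply: ge_ereal_inf; eexists.
    by exists optimal_marginal; [exact: optimal_marginal_density|reflexivity].
  apply: le_log2e.
    (* The constraint $\lambda\ge0$ in [Hmin] keeps the infimum nonnegative, as monotonicity of
       [log2e] requires. *)
    by apply: le_ereal_inf_tmp => _ [l [l0 _] <-]; rewrite lee_fin.
  apply: ge_ereal_inf; exists (B ^+ 2)%:E => //; exists (B ^+ 2) => //.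
  by split; [exact: ltW|exact: lowner_diag_state_optimal].
apply: le_ereal_inf_tmp => _ [s [_ tr1] <-]; rewrite -lB.
apply: le_log2e; first by rewrite lee_fin ltW.
apply: le_ereal_inf_tmp => _ [l [_ h] <-]; rewrite lee_fin.
exact: lowner_diag_state_ge h.
Qed.

End HminDiag.

(** * Counting circuits *)

Section RawCircuits.
Local Open Scope sesquilinear_scope.
Variables (R : realType) (G : gate_set R).

(* The wires of a gate need not be distinct here, which makes the gates on W a
   finite type. *)
Definition raw_gate (W : finType) : finType :=
  {g : G & {ffun 'I_(arity g) -> W}}.

Definition wires (W : finType) (q : raw_gate W) : {ffun 'I_(arity (tag q)) -> W} :=
  tagged q.

Definition agree_off (V W : finType) (f : V -> W) (x y : bits W) : bool :=
  [forall w, (w \notin codom f) ==> (x w == y w)].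

Definition raw_op (W : finType) (q : raw_gate W) : op R (bits W) (bits W) :=
  mkop (fun x y : bits W =>
    if agree_off (wires q) x y
    then entry (gate (tag q)) [ffun i => x (wires q i)] [ffun i => y (wires q i)]
    else 0).

Fixpoint raw_circuit_op (W : finType) (l : seq (raw_gate W)) :
    op R (bits W) (bits W) :=
  if l is q :: l' then raw_circuit_op l' *m raw_op q else 1%:M.

Definition forget_inj (W : finType) (q : placed_gate G W) : raw_gate W :=
  Tagged (fun g : G => {ffun 'I_(arity g) -> W}) (pwires q).

Lemma circuit_op_raw (W : finType) (c : seq (placed_gate G W)) :
  circuit_op c = raw_circuit_op (map (@forget_inj W) c).
Proof. by elim: c => //= q c ->. Qed.

Definition relabel (V W : finType) (h : V -> W) (q : raw_gate V) : raw_gate W :=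
  Tagged (fun g : G => {ffun 'I_(arity g) -> W}) [ffun i => h (wires q i)].

Definition restrict (V W : finType) (h : V -> W) (x : bits W) : bits V :=
  [ffun v => x (h v)].

(** Wires outside the image of [h] receive [false], the $|0\rangle$ of an ancilla. *)
Definition extend (V W : finType) (h : V -> W) (x : bits V) : bits W :=
  [ffun w => [exists v, (h v == w) && x v]].

Lemma extend_comp (U V W : finType) (g : U -> V) (h : V -> W) (x : bits U) :
  extend (h \o g) x = extend h (extend g x).
Proof.
apply/ffunP=> w; rewrite !ffunE; apply/existsP/existsP => -[].
  move=> u /andP[/eqP <- xu]; exists (g u); rewrite eqxx ffunE.
  by apply/existsP; exists u; rewrite eqxx.
move=> v; rewrite ffunE => /andP[/eqP <- /existsP[u /andP[/eqP <- xu]]].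
by exists u; rewrite eqxx.
Qed.

Section Injection.
Variables (V W : finType) (h : V -> W).
Hypothesis h_inj : injective h.

Lemma extendE (x : bits V) v : extend h x (h v) = x v.
Proof.
rewrite ffunE; apply/existsP/idP => [[u /andP[/eqP/h_inj ->]]//|xv].
by exists v; rewrite eqxx.
Qed.

Lemma extend_out (x : bits V) w : w \notin codom h -> extend h x w = false.
Proof.
move=> wh; rewrite ffunE; apply/existsP => -[v /andP[/eqP hv _]].
by rewrite -hv codom_f in wh.
Qed.

Lemma extendK : cancel (extend h) (restrict h).
Proof. by move=> x; apply/ffunP=> v; rewrite ffunE extendE. Qed.

Lemma codom_comp_inj (U : finType) (g : U -> V) v :
  (h v \in codom (h \o g)) = (v \in codom g).
Proof.
apply/codomP/codomP => [[u /h_inj ->]|[u ->]]; by exists u.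
Qed.

Lemma agree_off_extend (U : finType) (g : U -> V) (x y : bits V) :
  agree_off (h \o g) (extend h x) (extend h y) = agree_off g x y.
Proof.
apply/forallP/forallP => agr v.
  by have := agr (h v); rewrite !extendE codom_comp_inj.
have [/codomP[u ->]|vh] := boolP (v \in codom h).
  by rewrite !extendE codom_comp_inj; apply: agr.
by rewrite !extend_out // eqxx implybT.
Qed.

Lemma sum_extend (F : bits W -> R[i]) :
  (forall z, z != extend h (restrict h z) -> F z = 0) ->
  \sum_z F z = \sum_x F (extend h x).
Proof.
move=> F0; rewrite (bigID (fun z => z == extend h (restrict h z))) /=.
rewrite [X in _ + X]big1 ?addr0 //.
rewrite (reindex_onto (extend h) (restrict h)) => [|z /eqP <-//].
by apply: eq_bigl => x; rewrite extendK !eqxx.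
Qed.

(** A relabelled gate touches only wires in the image of [h], so the wires outside stay in
    $|0\rangle$. *)
Lemma entry_relabel (q : raw_gate V) (z : bits W) (y : bits V) :
  entry (raw_op (relabel h q)) z (extend h y) =
  (z == extend h (restrict h z))%:R * entry (raw_op q) (restrict h z) y.
Proof.
rewrite !entry_mkop /=.
have codomE : codom [ffun i => h (wires q i)] =i codom (h \o wires q).
  by move=> w; apply/codomP/codomP => -[i ->]; exists i; rewrite /= ?ffunE.
have -> : agree_off [ffun i => h (wires q i)] z (extend h y) =
    agree_off (h \o wires q) z (extend h y).
  by apply: eq_forallb => w; rewrite codomE.
have [zE|zE] := eqVneq z (extend h (restrict h z)).
  rewrite mul1r [in LHS]zE agree_off_extend; case: ifP => // _.
  by congr (entry _ _ _); apply/ffunP => i;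
    rewrite [LHS]ffunE [RHS]ffunE [X in extend h _ X]ffunE extendE.
rewrite mul0r ifF //; apply/negbTE; apply: contra zE => /forallP agr.
apply/eqP/ffunP => w; have [/codomP[v ->]|wh] := boolP (w \in codom h).
  by rewrite extendE ffunE.
rewrite extend_out //; have := agr w; rewrite extend_out // => /implyP/(_ _)/eqP -> //.
by apply: contra wh => /codomP[i ->]; exact: codom_f.
Qed.

Lemma entry_raw_circuit_relabel (l : seq (raw_gate V)) (z : bits W) (y : bits V) :
  entry (raw_circuit_op (map (relabel h) l)) z (extend h y) =
  (z == extend h (restrict h z))%:R * entry (raw_circuit_op l) (restrict h z) y.
Proof.
elim: l z y => [|q l IH] z y /=.
  rewrite !entry_scalar -natrM mulnb; congr (nat_of_bool _)%:R; apply/eqP/andP => [->|].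
    by rewrite extendK !eqxx.
  by case=> /eqP zE /eqP <-.
rewrite !entry_mulmx sum_extend => [|w /negbTE wE].
  rewrite mulr_sumr; apply: eq_bigr => w _.
  by rewrite IH entry_relabel extendK eqxx mul1r mulrA.
by rewrite entry_relabel wE mul0r mulr0.
Qed.

End Injection.

(* The overlap <x|T(|x><y|)|y> of the channel T computed by the circuit l whose
   input qubits are the wires g, the other wires being prepared in |0>, and whose
   output qubits are the wires f, the other wires being traced out. *)
Definition circuit_overlap (A W : finType) (l : seq (raw_gate W)) (f g : A -> W)
    (x y : bits A) : R[i] :=
  \sum_z \sum_z'
    [&& restrict f z == x, restrict f z' == y & agree_off f z z']%:R *
    (entry (raw_circuit_op l) z (extend g x) *
     (entry (raw_circuit_op l) z' (extend g y))^*).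

(** Idle wires begin and end in $|0\rangle$, so they add a single term to the partial trace. *)
Lemma circuit_overlap_relabel (A V W : finType) (h : V -> W)
    (l : seq (raw_gate V)) (f g : A -> V) (x y : bits A) :
  injective h ->
  circuit_overlap (map (relabel h) l) (h \o f) (h \o g) x y =
  circuit_overlap l f g x y.
Proof.
move=> h_inj; rewrite /circuit_overlap (extend_comp g h x) (extend_comp g h y).
rewrite (sum_extend h_inj) => [|z /negbTE zE]; last first.
  rewrite big1 // => z' _.
  by rewrite (entry_raw_circuit_relabel h_inj) zE mul0r mul0r mulr0.
apply: eq_bigr => z _.
rewrite (sum_extend h_inj) => [|z' /negbTE zE]; last first.
  by rewrite !(entry_raw_circuit_relabel h_inj) zE mul0r conjC0 !mulr0.
apply: eq_bigr => z' _.
rewrite !(entry_raw_circuit_relabel h_inj) !(extendK h_inj) !eqxx !mul1r.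
rewrite (agree_off_extend h_inj); congr (_ * _).
have restrictE (t : bits V) : restrict (h \o f) (extend h t) = restrict f t.
  by apply/ffunP => a; rewrite [LHS]ffunE [RHS]ffunE extendE.
by rewrite !restrictE.
Qed.

Lemma exists_relabel_preimage (W : finType) (s : seq W) (l : seq (raw_gate W)) :
  all (fun q => all (mem s) (codom (wires q))) l ->
  exists l0 : seq (raw_gate (seq_sub s)), l = map (relabel val) l0.
Proof.
elim: l => [|q l IH] /=; first by exists [::].
case/andP => /allP qs /IH[l0 ->].
have ms i : wires q i \in s by apply: qs; exact: codom_f.
exists (Tagged (fun g : G => {ffun 'I_(arity g) -> seq_sub s})
  [ffun i => SeqSub (ms i)] :: l0) => /=; congr (_ :: _).
case: q ms {qs} => g pw /= ms; rewrite /relabel /=; congr existT.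
by apply/ffunP => i; rewrite !ffunE.
Qed.

Definition max_arity : nat := \max_(g : G) arity g.

(** Gate complexity puts no bound on the number of ancillas. Only the wires that are inputs, outputs
    or touched by a gate matter, and these can be moved into ['I_w]; this makes the set of overlaps
    finite. *)
Lemma circuit_overlap_few_wires (A W : finType) (l : seq (raw_gate W))
    (f g : A -> W) (w : nat) :
  (2 * #|A| + max_arity * size l <= w)%N ->
  exists (l' : seq (raw_gate 'I_w)) (f' g' : {ffun A -> 'I_w}),
    size l' = size l /\
    forall x y, circuit_overlap l f g x y = circuit_overlap l' f' g' x y.
Proof.
move=> lw.
pose s := codom f ++ codom g ++ flatten [seq codom (wires q) | q <- l].
have fs a : f a \in s by rewrite mem_cat codom_f.
have gs a : g a \in s by rewrite !mem_cat codom_f orbT.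
have [l0 lE] : exists l0 : seq (raw_gate (seq_sub s)), l = map (relabel val) l0.
  apply: exists_relabel_preimage; apply/allP => q ql; apply/allP => v vq.
  rewrite /= /s !mem_cat; apply/orP; right; apply/orP; right.
  by apply/flattenP; exists (codom (wires q)) => //; apply: map_f.
have sw : (#|{: seq_sub s}| <= w)%N.
  apply: (@leq_trans (size s)).
    rewrite cardE -(size_map val); apply: uniq_leq_size.
      by rewrite (map_inj_uniq val_inj) enum_uniq.
    by move=> v /mapP[u _ ->]; exact: ssvalP.
  apply: leq_trans lw; rewrite !size_cat !size_codom addnA addnn mul2n leq_add2l.
  rewrite size_flatten /shape -map_comp.
  elim: (l) => [|q l1 IH] //=.
  rewrite mulnS leq_add // size_codom card_ord.
  exact: (leq_bigmax (tag q)).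
pose h (v : seq_sub s) := widen_ord sw (enum_rank v).
have h_inj : injective h.
  by move=> u v /(congr1 val) /= /val_inj /enum_rank_inj.
exists (map (relabel h) l0), [ffun a => h (SeqSub (fs a))], [ffun a => h (SeqSub (gs a))].
split; first by rewrite lE !size_map.
move=> x y.
transitivity (circuit_overlap l0 (fun a => SeqSub (fs a)) (fun a => SeqSub (gs a)) x y).
  by rewrite lE -[RHS](circuit_overlap_relabel _ _ _ _ _ val_inj).
rewrite -[LHS](circuit_overlap_relabel _ _ _ _ _ h_inj).
by congr (circuit_overlap _ _ _ x y); apply/funext => a; rewrite ffunE.
Qed.

(** The output assignment [out] is pulled back to the wires of the circuit: output qubit [a] is the
    wire [out' (inl a)], and tracing out the others means agreement off these wires. *)
Lemma implements_overlap (A : finType) (e l : nat)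
    (c : seq (placed_gate G (A + 'I_e)%type)) (out : A + 'I_e -> A + 'I_l)
    (out' : A + 'I_l -> A + 'I_e)
    (T : {linear op R (bits A) (bits A) -> op R (bits A) (bits A)}) x y :
  cancel out out' -> cancel out' out -> implements c out T ->
  overlap T x y =
  circuit_overlap (map (@forget_inj _) c) (fun a => out' (inl a)) inl x y.
Proof.
move=> outK outK' cT; rewrite /overlap /unit_image cT entry_mkop.
have -> : tens (delta_mx (enum_rank x) (enum_rank y)) (projector (ket0 R 'I_e)) =
   delta_mx (enum_rank (x, [ffun=> false])) (enum_rank (y, [ffun=> false])) :> op R _ _.
  apply: op_ext => -[u u'] [v v'].
  rewrite entry_tens !entry_delta entry_projector !amp_mkvec /= conjC_nat -!natrM !mulnb.
  by congr (nat_of_bool _)%:R; rewrite !xpair_eqE andbACA.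
under eq_bigr => k _ do rewrite entry_conjugate_delta !entry_mkop circuit_op_raw.
set C := raw_circuit_op _.
have split0 (w : bits A) : split_bits id (w, [ffun=> false]) = extend inl w :> bits (A + 'I_e).
  apply/ffunP => -[a|b]; rewrite !ffunE /=.
    by apply/idP/existsP => [wa|[a' /andP[/eqP[->]]]//]; exists a; rewrite eqxx.
  by apply/esym/negbTE/existsP => -[].
rewrite !split0.
pose join (z : bits (A + 'I_e)) : bits A * bits 'I_l :=
  ([ffun a => z (out' (inl a))], [ffun b => z (out' (inr b))]).
have splitK : cancel (split_bits out) join.
  by move=> [u v]; congr (_, _); apply/ffunP => a; rewrite !ffunE outK'.
have joinK : cancel join (split_bits out).
  move=> z; apply/ffunP => w; rewrite ffunE.
  by case E: (out w) => [a|b]; rewrite ffunE -E outK.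
have split_bij : bijective (split_bits out) by exists join.
pose f a := out' (@inl A 'I_l a).
have restrict_split o : restrict f (split_bits out o) = o.1.
  by apply/ffunP => a; rewrite !ffunE outK'.
have agree_split o o' :
    agree_off f (split_bits out o) (split_bits out o') = (o.2 == o'.2).
  apply/forallP/eqP => [agr|oo' w].
    apply/ffunP => b; have := agr (out' (inr b)); rewrite !ffunE outK'.
    move/implyP => h; apply/eqP/h; apply/codomP => -[a].
    by move/(can_inj outK').
  apply/implyP; rewrite !ffunE; case E: (out w) => [a|b]; last by rewrite oo'.
  by case/codomP; exists a; rewrite /f -E outK.
rewrite /circuit_overlap -/f.
rewrite (reindex (split_bits out)) /=; last exact: onW_bij.
(* Given [o], the only surviving second index is [(y, o.2)]. *)
transitivity (\sum_o (o.1 == x)%:R * (entry C (split_bits out o) (extend inl x) *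
    (entry C (split_bits out (y, o.2)) (extend inl y))^*)).
  rewrite -(pair_bigA _ (fun a k => (a == x)%:R *
    (entry C (split_bits out (a, k)) (extend inl x) *
     (entry C (split_bits out (y, k)) (extend inl y))^*))) /=.
  rewrite [RHS](bigD1 x) //= [X in _ + X]big1 ?addr0 => [|a /negbTE ax]; last first.
    by rewrite big1 // => k _; rewrite ax mul0r.
  by apply: eq_bigr => k _; rewrite eqxx mul1r.
apply: eq_bigr => o _; rewrite (reindex (split_bits out)) /=; last exact: onW_bij.
rewrite (bigD1 (y, o.2)) //= [X in _ + X]big1 ?addr0 => [|[a k] ak].
  by rewrite !restrict_split agree_split !eqxx !andbT.
rewrite !restrict_split agree_split /= (eq_sym o.2 k).
by move: ak; rewrite xpair_eqE => /negbTE ->; rewrite andbF mul0r.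
Qed.

(** Gate counts are integers: if all exceeded [Num.truncn t], the infimum would be at least one more
    than that, hence above $t$. *)
Lemma exists_small_circuit (A : finType) (t : R)
    (T : {linear op R (bits A) (bits A) -> op R (bits A) (bits A)}) :
  (gate_complexity G T <= t%:E)%E ->
  exists (e l : nat) (c : seq (placed_gate G (A + 'I_e)%type))
    (out : A + 'I_e -> A + 'I_l),
    [/\ bijective out, implements c out T & (size c <= Num.truncn t)%N].
Proof.
move=> Tt; apply: contrapT => noc.
suff : ((Num.truncn t).+1%:R%:E <= gate_complexity G T)%E.
  move=> /le_trans/(_ Tt); rewrite lee_fin leNgt => /negP[].
  exact: truncnS_gt.
apply: le_ereal_inf_tmp => _ [e [l [c [out [outb cT ->]]]]].
rewrite lee_fin ler_nat ltnNge; apply/negP => ct.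
by apply: noc; exists e, l, c, out.
Qed.

(* None stands for the absence of a gate, so that codes describe the circuits
   with at most S gates. *)
Definition circuit_code (A : finType) (w S : nat) : finType :=
  ({ffun A -> 'I_w} * {ffun A -> 'I_w} * S.-tuple (option (raw_gate 'I_w)))%type.

Definition code_overlap (A : finType) (w S : nat) (d : circuit_code A w S) :
    bits A -> bits A -> R[i] :=
  circuit_overlap (pmap id d.2) d.1.1 d.1.2.

Lemma exists_code (A : finType) (t : R) (w : nat)
    (T : {linear op R (bits A) (bits A) -> op R (bits A) (bits A)}) :
  (2 * #|A| + max_arity * Num.truncn t <= w)%N ->
  (gate_complexity G T <= t%:E)%E ->
  exists d : circuit_code A w (Num.truncn t), overlap T =2 code_overlap d.
Proof.
move=> tw /exists_small_circuit[e [l [c [out [[out' outK outK'] cT ct]]]]].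
have [|l' [f' [g' [sl' lE]]]] := @circuit_overlap_few_wires A _
    (map (@forget_inj _) c) (fun a => out' (inl a)) inl w.
  by apply: leq_trans tw; rewrite size_map leq_add2l leq_mul2l ct orbT.
(* Padding with [None] gives the exact tuple length, and [pmap id] removes it again. *)
pose s := map Some l' ++ nseq (Num.truncn t - size l') None.
have ss : size s == Num.truncn t.
  by rewrite size_cat size_map size_nseq subnKC // sl' size_map.
exists (f', g', Tuple ss) => x y.
rewrite (implements_overlap _ _ outK outK' cT) lE /code_overlap /=.
suff -> : pmap id s = l' by [].
rewrite pmap_cat map_pK // [X in _ ++ X](_ : _ = [::]) ?cats0 //.
by elim: (_ - _)%N.
Qed.

(** Each slot is empty or holds a gate with at most [max_arity] wires; $w>0$ allows each arity to be
    raised to the maximum. *)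
Lemma card_code (A : finType) (w S : nat) : (0 < w)%N ->
  (#|circuit_code A w S| <= w ^ #|A| * w ^ #|A| * (#|G| * w ^ max_arity).+1 ^ S)%N.
Proof.
move=> w0; rewrite !card_prod !card_ffun card_tuple card_option card_ord.
rewrite leq_mul2l; apply/orP; right; apply: leq_exp2r_weak.
rewrite ltnS card_tagged sumnE big_map big_enum /= -sum_nat_const.
apply: leq_sum => g _; rewrite card_ffun !card_ord.
by rewrite leq_pexp2l // leq_bigmax.
Qed.

End RawCircuits.

(** * Product states and phase states *)

Section Copies.
Local Open Scope sesquilinear_scope.
Variables (R : realType) (A : finType) (k : nat).

Definition copy_label (x : bits ('I_k * A)%type) (j : 'I_k) : bits A :=
  [ffun a => x (j, a)].

Lemma copy_label_inj x y : copy_label x =1 copy_label y -> x = y.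
Proof.
by move=> xy; apply/ffunP => -[j a]; have /ffunP/(_ a) := xy j; rewrite !ffunE.
Qed.

Definition copies_weight (a : bits A -> R) (x : bits ('I_k * A)%type) : R :=
  \prod_(j < k) a (copy_label x j).

(** Two distinct joint labels differ in some copy, and the factor of that copy vanishes. *)
Lemma copies_diag_state (a : bits A -> R) :
  copies k (diag_state a) = diag_state (copies_weight a).
Proof.
apply/matrixP => i j; rewrite !mxE; move: (enum_val i) => [x y] /=.
have [<-|xy] := eqVneq x y.
  rewrite mul1r rmorph_prod; apply: eq_bigr => l _.
  by rewrite amp_mkvec /= eqxx mul1r.
rewrite mul0r; apply/eqP/prodf_eq0.
have [l xyl] : exists l, copy_label x l != copy_label y l.
  apply/existsP; apply: contraNT xy; rewrite negb_exists => /forallP xy.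
  by apply/eqP/copy_label_inj => l; apply/eqP; have := xy l; rewrite negbK.
by exists l => //; rewrite amp_mkvec /= (negbTE xyl) mul0r.
Qed.

Lemma sum_norm_copies_weight (a : bits A -> R) :
  \sum_x `|copies_weight a x| = (\sum_x `|a x|) ^+ k.
Proof.
rewrite -[in RHS](card_ord k) -prodr_const bigA_distr_bigA /=.
pose unpack (f : {ffun 'I_k -> bits A}) : bits ('I_k * A)%type :=
  [ffun u => f u.1 u.2].
have packK : cancel unpack (fun x => [ffun j => copy_label x j]).
  by move=> f; apply/ffunP => j; apply/ffunP => i; rewrite !ffunE.
have unpackK : cancel (fun x => [ffun j => copy_label x j]) unpack.
  by move=> x; apply/ffunP => -[j i]; rewrite !ffunE.
rewrite (reindex unpack) /=; last by apply: onW_bij; exists (fun x => [ffun j => copy_label x j]).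
apply: eq_bigr => f _; rewrite normr_prod; apply: eq_bigr => j _.
by congr `|a _|; apply/ffunP => i; rewrite !ffunE.
Qed.

Lemma Hmin_copies_diag_state (a : bits A -> R) : 0 < \sum_x `|a x| ->
  Hmin (projector (copies k (diag_state a))) =
  (- (k%:R * (2 * log2 (\sum_x `|a x|))))%:E.
Proof.
move=> a0; rewrite copies_diag_state Hmin_diag_state sum_norm_copies_weight ?exprn_gt0 //.
congr (- _)%:E; rewrite /log2 lnXn // -mulr_natl.
by ring.
Qed.

Lemma unit_vec_diag_state (I : finType) (b : I -> R) :
  \sum_x b x ^+ 2 = 1 -> unit_vec (diag_state b).
Proof.
move=> b1; rewrite /unit_vec /mxtrace big_ord1 mxE sum_enum_rank.
transitivity (\sum_u (amp (diag_state b) u)^* * amp (diag_state b) u).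
  by apply: eq_bigr => u _; rewrite /amp !mxE.
rewrite overlap_diag_state -(rmorph1 (@real_complex R)) -b1 rmorph_sum.
apply: eq_bigr => x _ /=.
by rewrite amp_mkvec /= eqxx mul1r conjC_real -rmorphM.
Qed.

End Copies.

Section ProductState.
Variables (R : realType) (G : gate_set R) (A : finType).

Definition zero_weight (x : bits A) : R := (x == [ffun=> false])%:R.

Lemma sum_norm_zero_weight : \sum_x `|zero_weight x| = 1.
Proof.
rewrite (bigD1 [ffun=> false]) //= big1 => [|x x0].
  by rewrite /zero_weight eqxx normr1 addr0.
by rewrite /zero_weight (negbTE x0) normr0.
Qed.

Lemma unit_vec_zero_state : unit_vec (diag_state zero_weight).
Proof.
apply: unit_vec_diag_state; rewrite -[RHS]sum_norm_zero_weight; apply: eq_bigr => x _.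
by rewrite /zero_weight; case: eqP; rewrite ?normr0 ?normr1 ?expr0n ?expr1n.
Qed.

Lemma Hmin_zero_state k : Hmin (projector (copies k (diag_state zero_weight))) = 0%:E.
Proof.
rewrite Hmin_copies_diag_state sum_norm_zero_weight ?ltr01 //.
by rewrite /log2 ln1 mul0r !mulr0 oppr0.
Qed.

(** Overlaps have modulus at most 1, so the form is at most $(\sum_x|b_x|)^2=1$ for every channel,
    whatever the budget. *)
Lemma comp_Hmin_zero_state k (t l : R) : 0 <= l ->
  ((- l)%:E <= comp_Hmin G t (projector (copies k (diag_state zero_weight))))%E.
Proof.
move=> l0; apply: comp_Hmin_ge => T Tcptp _.
rewrite copies_diag_state trace_diag_state_choi //.
have l1 : 1 <= 2 `^ l by rewrite -[leLHS](powRr0 2) ler_powR // ler1n.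
apply: (@le_trans _ _ 1); last by rewrite -(rmorph1 (@real_complex R)) lecR.
set b := copies_weight _.
have -> : 1 = (\sum_x `|b x|%:C%C) * (\sum_x `|b x|%:C%C) :> R[i].
  by rewrite -rmorph_sum sum_norm_copies_weight sum_norm_zero_weight expr1n mulr1.
have S0 := overlap_real_form_ge0 Tcptp b.
rewrite -(ger0_norm S0) big_distrlr /=.
apply: le_trans (ler_norm_sum _ _ _) _; apply: ler_sum => x _.
apply: le_trans (ler_norm_sum _ _ _) _; apply: ler_sum => y _.
rewrite normrM normC_real normrM rmorphM /= ler_piMr //.
  by rewrite -rmorphM lecR mulr_ge0.
exact: norm_overlap_le1.
Qed.

End ProductState.

Section PhaseState.
Variables (R : realType) (G : gate_set R) (A : finType).

Definition phase_weight (s : {ffun bits A -> bool}) (x : bits A) : R :=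
  sign R s x / Num.sqrt (2 ^ #|A|)%:R.

Let dim_gt0 : 0 < (2 ^ #|A|)%:R :> R.
Proof. by rewrite ltr0n expn_gt0. Qed.

Let card_bits : #|{: bits A}| = (2 ^ #|A|)%N.
Proof. by rewrite card_ffun card_bool. Qed.

Lemma sum_norm_phase_weight s :
  \sum_x `|phase_weight s x| = Num.sqrt (2 ^ #|A|)%:R.
Proof.
rewrite (eq_bigr (fun=> (Num.sqrt (2 ^ #|A|)%:R)^-1)) => [|x _]; last first.
  by rewrite normrM normr_sign mul1r normfV ger0_norm // sqrtr_ge0.
rewrite sumr_const card_bits -[LHS]mulr_natl.
by rewrite -{1}(@sqr_sqrtr _ _ (ltW dim_gt0)) expr2 mulfK // sqrtr_eq0 -ltNge.
Qed.

Lemma unit_vec_phase_state s : unit_vec (diag_state (phase_weight s)).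
Proof.
apply: unit_vec_diag_state.
rewrite (eq_bigr (fun=> ((2 ^ #|A|)%:R)^-1)) => [|x _]; last first.
  by rewrite exprMn sqrr_sign mul1r exprVn sqr_sqrtr // ltW.
by rewrite sumr_const card_bits -[LHS]mulr_natl divff // gt_eqF.
Qed.

Lemma Hmin_phase_state k s :
  Hmin (projector (copies k (diag_state (phase_weight s)))) =
  (- (k%:R * #|A|%:R))%:E.
Proof.
rewrite Hmin_copies_diag_state sum_norm_phase_weight ?sqrtr_gt0 //.
congr (- (_ * _))%:E.
have ln2 : ln (2 : R) != 0 by rewrite gt_eqF // ln_gt0 // ltr1n.
have -> : 2 * log2 (Num.sqrt (2 ^ #|A|)%:R) = log2 (Num.sqrt (2 ^ #|A|)%:R ^+ 2) :> R.
  by rewrite /log2 lnXn ?sqrtr_gt0 // mulr_natl mulrnAl.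
by rewrite sqr_sqrtr ?ltW // natrX /log2 lnXn // -[_ *+ #|A|]mulr_natl mulfK.
Qed.

Lemma signsE k s z :
  (signs R (@copy_label A k) s z)%:C%C = signs R[i] (@copy_label A k) s z.
Proof.
rewrite /signs rmorph_prod; apply: eq_bigr => j _.
by rewrite /sign /= rmorph_sign.
Qed.

Lemma trace_phase_state_choi k s
    (T : {linear op R (bits ('I_k * A)%type) (bits ('I_k * A)%type) ->
                 op R (bits ('I_k * A)%type) (bits ('I_k * A)%type)}) :
  cptp T ->
  \tr (projector (copies k (diag_state (phase_weight s))) *m choi T) =
  sign_form (@copy_label A k) (overlap T) s / (2 ^ #|A|)%:R ^+ k.
Proof.
move=> Tcptp; rewrite copies_diag_state trace_diag_state_choi // /sign_form mulr_suml.
apply: eq_bigr => x _; rewrite mulr_suml; apply: eq_bigr => y _.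
rewrite mulrAC; congr (_ * _).
have wE z : copies_weight (phase_weight s) z =
    signs R (@copy_label A k) s z / Num.sqrt (2 ^ #|A|)%:R ^+ k.
  by rewrite /copies_weight big_split /= prodr_const card_ord exprVn.
rewrite !wE mulrACA -invfM -exprMn -expr2 sqr_sqrtr; last exact: ltW.
by rewrite !rmorphM /= fmorphV rmorphXn /= !signsE rmorph_nat.
Qed.

(** The union bound runs over circuit codes, with [X] the labels of one copy and [Y] those of $k$
    copies; the factor $2^{k|A|}$ in its bound cancels the normalisation of the state. *)
Lemma exists_low_overlap_signs (k l m w : nat) (t : R) :
  (0 < k)%N -> (0 < w)%N ->
  (2 * (k * #|A|) + max_arity G * Num.truncn t <= w)%N ->
  (w ^ (k * #|A|) * w ^ (k * #|A|) * (#|G| * w ^ max_arity G).+1 ^ Num.truncn t < 2 ^ l)%N ->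
  (2 * (k * l) ^ 2 <= 2 ^ m)%N ->
  exists s, ((- (k%:R * m%:R))%:E <=
    comp_Hmin G t (projector (copies k (diag_state (phase_weight s)))))%E.
Proof.
move=> k0 w0 tw codes_l lm.
have cA : #|{: 'I_k * A}| = (k * #|A|)%N by rewrite card_prod card_ord.
pose C := circuit_code G ('I_k * A)%type w (Num.truncn t).
(* A code may describe no channel; the modulus and positivity bounds are available for those that
   reproduce the overlaps of one. *)
pose P (d : C) := `[< exists T : {linear op R (bits ('I_k * A)%type) (bits ('I_k * A)%type) ->
    op R (bits ('I_k * A)%type) (bits ('I_k * A)%type)},
    cptp T /\ overlap T = @code_overlap _ _ _ _ _ d >].
have [|||s sP] := @exists_good_signs R[i] (bits A) _ k (@copy_label A k)
    (@copy_label_inj A k) [ffun=> false] l m C P (@code_overlap _ _ _ _ _) k0 _ lm.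
- by apply: leq_ltn_trans codes_l; rewrite -cA card_code.
- by move=> d /asboolP[T [Tcptp <-]] y z; exact: norm_overlap_le1.
- move=> d /asboolP[T [Tcptp <-]] s; rewrite /sign_form.
  have := overlap_real_form_ge0 Tcptp (signs R (@copy_label A k) s).
  move=> h; apply: le_trans h _; rewrite le_eqVlt; apply/orP; left; apply/eqP.
  apply: eq_bigr => x _; apply: eq_bigr => y _.
  by rewrite rmorphM /= !signsE.
exists s; apply: comp_Hmin_ge => T Tcptp Tt.
have [|d dE] := @exists_code _ _ ('I_k * A)%type t w T _ Tt; first by rewrite cA.
have {}dE : overlap T = code_overlap d by apply/funext => x; apply/funext => y.
rewrite trace_phase_state_choi // dE.
have Pd : P d by apply/asboolP; exists T.
have := sP d Pd; rewrite card_bits => h.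
rewrite ler_pdivrMr; last by rewrite exprn_gt0 // ltr0n expn_gt0.
apply: le_trans h _.
by rewrite -natrM powR_mulrn // rmorphXn /= rmorph_nat natrM !natrX mulnC.
Qed.

End PhaseState.

(** * Asymptotics *)

Section Asymptotics.
Local Open Scope nat_scope.

(** A pure power suffices since the bound is only eventual: constants are absorbed by a larger
    exponent or threshold. *)
Definition poly_bounded (f : nat -> nat) : Prop :=
  exists e N0, forall N, N0 <= N -> f N <= N ^ e.

Lemma poly_bounded_const c : poly_bounded (fun=> c).
Proof. by exists 1, c. Qed.

Lemma poly_bounded_id : poly_bounded id.
Proof. by exists 1, 0. Qed.

Lemma poly_bounded_le f g : (forall N, 0 < N -> f N <= g N) ->
  poly_bounded g -> poly_bounded f.
Proof.
move=> fg [e [N0 gP]]; exists e, N0.+1 => N N0N.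
apply: leq_trans (gP N (ltnW N0N)); apply: fg; exact: leq_ltn_trans N0N.
Qed.

Lemma poly_boundedM f g : poly_bounded f -> poly_bounded g ->
  poly_bounded (fun N => f N * g N).
Proof.
move=> [e [N0 fP]] [e' [N0' gP]]; exists (e + e'), (maxn N0 N0') => N.
by rewrite geq_max => /andP[N0N N0'N]; rewrite expnD leq_mul ?fP ?gP.
Qed.

Lemma poly_boundedD f g : poly_bounded f -> poly_bounded g ->
  poly_bounded (fun N => f N + g N).
Proof.
move=> [e [N0 fP]] [e' [N0' gP]].
exists (maxn e e').+1, (maxn 2 (maxn N0 N0')) => N.
rewrite !geq_max => /and3P[N2 N0N N0'N].
have N_gt0 : 0 < N by exact: ltnW.
apply: (@leq_trans (2 * N ^ maxn e e')); last by rewrite expnS leq_mul2r N2 orbT.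
rewrite mul2n -addnn leq_add //.
  by apply: leq_trans (fP N N0N) _; rewrite leq_pexp2l // leq_maxl.
by apply: leq_trans (gP N N0'N) _; rewrite leq_pexp2l // leq_maxr.
Qed.

Lemma poly_boundedX f d : poly_bounded f -> poly_bounded (fun N => f N ^ d).
Proof.
move=> [e [N0 fP]]; exists (e * d), N0 => N N0N.
by rewrite expnM leq_exp2r_weak // fP.
Qed.

(** From $a\le2^a$ follows $a^b\le2^{ab}$, so the logarithm of the code count is polynomial; the
    successor makes the bound strict. *)
Lemma code_count_lt (w u v S : nat) :
  w ^ u * w ^ u * v ^ S < 2 ^ (w * u + w * u + v * S).+1.
Proof.
have pow2 a b : a ^ b <= 2 ^ (a * b).
  by rewrite expnM leq_exp2r_weak // ltnW // ltn_expl.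
rewrite expnS !expnD; apply: (@leq_ltn_trans (2 ^ (w * u) * 2 ^ (w * u) * 2 ^ (v * S))).
  by rewrite !leq_mul.
by rewrite ltn_Pmull // !muln_gt0 !expn_gt0.
Qed.

End Asymptotics.

Section PolynomialBounds.
Variable R : realType.

Lemma horner_nat_le (q : {poly R}) :
  exists C e : nat, forall n : nat, (0 < n)%N -> q.[n%:R] <= (C * n ^ e)%:R.
Proof.
exists (Num.truncn (\sum_(i < size q) `|q`_i|)).+1, (size q) => n n0.
rewrite horner_coef natrM natrX.
apply: (@le_trans _ _ (\sum_(i < size q) `|q`_i| * n%:R ^+ size q)).
  apply: ler_sum => i _; apply: (@le_trans _ _ (`|q`_i| * n%:R ^+ i)).
    by rewrite ler_wpM2r ?exprn_ge0 // ler_norm.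
  by rewrite ler_wpM2l // ler_weXn2l ?ler1n // ltnW.
rewrite -mulr_suml ler_wpM2r ?exprn_ge0 //.
exact/ltW/truncnS_gt.
Qed.

(** The argument is doubled because $n=2N$, and the maximum with 0 covers truncations of negative
    values. *)
Lemma poly_bounded_horner (q : {poly R}) (f : nat -> nat) :
  (forall N, (f N)%:R <= Num.max 0 q.[(N.*2)%:R]) -> poly_bounded f.
Proof.
have [C [e qP]] := horner_nat_le q => fq.
apply: (@poly_bounded_le _ (fun N => C * (2 * N) ^ e)%N) => [N N0|].
  rewrite -(ler_nat R); apply: le_trans (fq N) _.
  by rewrite ge_max ler0n mul2n qP ?double_gt0.
apply: poly_boundedM; first exact: poly_bounded_const.
apply/poly_boundedX/poly_boundedM; [exact: poly_bounded_const|exact: poly_bounded_id].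
Qed.

(** Eventually $m(N)\ge e\log N$, that is $N^e\le2^{m(N)}$; $N\ge2$ keeps the logarithm positive. *)
Lemma poly_bounded_superlog (f m : nat -> nat) :
  poly_bounded f ->
  ((m N)%:R / log2 (N%:R : R) : R) @[N --> \oo] --> +oo ->
  exists N0, forall N, (N0 <= N)%N -> (f N <= 2 ^ m N)%N.
Proof.
move=> [e [N0 fP]] /cvgryPge/(_ e%:R)[N1 _ mP].
exists (maxn 2 (maxn N0 N1)) => N; rewrite !geq_max => /and3P[N2 N0N N1N].
apply: leq_trans (fP N N0N) _; rewrite -(ler_nat R) !natrX.
have := mP N N1N; rewrite /=.
have lnN : 0 < ln (N%:R : R) by rewrite ln_gt0 // ltr1n.
have ln2 : 0 < ln (2 : R) by rewrite ln_gt0 // ltr1n.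
rewrite ler_pdivlMr ?divr_gt0 // /log2 mulrA ler_pdivrMr // !mulr_natl => h.
have N_gt0 : 0 < N%:R :> R by rewrite ltr0n ltnW.
by rewrite -ler_ln ?posrE ?exprn_gt0 // !lnXn.
Qed.

End PolynomialBounds.

Section LargeN.
Variables (R : realType) (G : gate_set R) (p : {poly R}) (m k : nat -> nat).
Hypothesis m_omega : ((m N)%:R / log2 (N%:R : R) : R) @[N --> \oo] --> +oo.
Hypothesis k_poly : exists q : {poly R}, forall n : nat, ~~ odd n ->
  (k n)%:R <= q.[n%:R].

Lemma exists_low_overlap_signs_eventually :
  exists N0, forall N, (N0 <= N)%N -> (0 < k N.*2)%N ->
    exists s, ((- ((k N.*2)%:R * (m N)%:R))%:E <=
      comp_Hmin G p.[(N.*2)%:R] (projector (copies (k N.*2)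
        (diag_state (@phase_weight R 'I_N s)))))%E.
Proof.
(* [S] bounds the gates, [w] the relevant wires, [v] the options per slot, and $2^l$ strictly
   exceeds the number of codes. The 1 in [w] makes it positive, the 1 in [v] counts the empty
   slot. *)
pose S N := Num.truncn p.[(N.*2)%:R].
pose w N := (2 * (k N.*2 * N) + max_arity G * S N + 1)%N.
pose v N := (#|G| * w N ^ max_arity G + 1)%N.
pose l N := (w N * (k N.*2 * N) + w N * (k N.*2 * N) + v N * S N + 1)%N.
have k_pb : poly_bounded (fun N => k N.*2).
  have [q kq] := k_poly; apply: (@poly_bounded_horner _ q) => N.
  by rewrite le_max kq ?orbT // odd_double.
have S_pb : poly_bounded S.
  apply: (@poly_bounded_horner _ p) => N; rewrite /S.
  have [x0|x0] := leP 0 p.[(N.*2)%:R]; first by rewrite truncn_le.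
  by have /truncn0Pn -> := negbT (lt_geF (lt_trans x0 (@ltr01 R))).
have w_pb : poly_bounded w.
  by rewrite /w; repeat first [exact: k_pb | exact: S_pb | exact: poly_bounded_const
    | exact: poly_bounded_id | apply: poly_boundedD | apply: poly_boundedM].
have v_pb : poly_bounded v.
  apply: poly_boundedD; last exact: poly_bounded_const.
  by apply: poly_boundedM; [exact: poly_bounded_const|exact: poly_boundedX].
have l_pb : poly_bounded l.
  by rewrite /l; repeat first [exact: k_pb | exact: S_pb | exact: w_pb | exact: v_pb
    | exact: poly_bounded_const | exact: poly_bounded_id
    | apply: poly_boundedD | apply: poly_boundedM].
have f_pb : poly_bounded (fun N => 2 * (k N.*2 * l N) ^ 2)%N.
  apply: poly_boundedM; first exact: poly_bounded_const.
  exact/poly_boundedX/poly_boundedM.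
have [N0 fm] := poly_bounded_superlog f_pb m_omega.
exists N0 => N N0N kN.
apply: (@exists_low_overlap_signs R G 'I_N (k N.*2) (l N) (m N) (w N)) => //.
- by rewrite /w addn1.
- by rewrite card_ord /w leq_addr.
- have vE : v N = (#|G| * w N ^ max_arity G).+1 by rewrite /v addn1.
  by rewrite card_ord -vE /l addn1; exact: code_count_lt.
- exact: fm.
Qed.

End LargeN.

(** * Assembly of the family of states *)

Unset Implicit Arguments.

Theorem mainTheorem5 (R : realType) (G : gate_set R) (p : {poly R})
    (standing : forall n : nat, ~~ odd n ->
       spanning G p.[n%:R] 'I_(n./2) 'I_(n./2))
    (m : nat -> nat)
    (m_omega : ((m N)%:R / log2 (N%:R : R) : R) @[N --> \oo] --> +oo)
    (k : nat -> nat)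
    (k_poly : exists q : {poly R}, forall n : nat, ~~ odd n ->
       (k n)%:R <= q.[n%:R]) :
  exists psi : forall n : nat, vec R (bits 'I_(n./2) * bits 'I_(n./2))%type,
    (forall n : nat, ~~ odd n -> unit_vec (psi n)) /\
    exists (c : nat -> R) (c_max : R),
      (forall n : nat, ~~ odd n -> `|c n| <= c_max) /\
      (forall n : nat, ~~ odd n ->
         Hmin (projector (copies (k n) (psi n))) =
           (- ((k n)%:R * ((n./2)%:R - c n)))%:E /\
         ((- ((k n)%:R * (m n./2)%:R))%:E <=
           comp_Hmin G p.[n%:R] (projector (copies (k n) (psi n))))%E).
Proof.
have [N0 large] := @exists_low_overlap_signs_eventually R G p m k m_omega k_poly.
(* The state and its $O(1)$ term are chosen together for each $n$; [N0] serves as the uniform bound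
   on that term. *)
suff stateP n : exists (psi_c : vec R (bits 'I_(n./2) * bits 'I_(n./2))%type * R),
    ~~ odd n -> [/\ unit_vec psi_c.1, `|psi_c.2| <= N0%:R,
      Hmin (projector (copies (k n) psi_c.1)) =
        (- ((k n)%:R * ((n./2)%:R - psi_c.2)))%:E &
      ((- ((k n)%:R * (m n./2)%:R))%:E <=
        comp_Hmin G p.[n%:R] (projector (copies (k n) psi_c.1)))%E].
  pose sel n := projT1 (cid (stateP n)).
  have selP n : ~~ odd n -> _ := projT2 (cid (stateP n)).
  exists (fun n => (sel n).1); split=> [n /selP[]//|].
  exists (fun n => (sel n).2), N0%:R; split=> [n /selP[]//|n /selP[_ _ H1 H2]].
  by split.
have /orP[n_odd|n_even] := orbN (odd n); first by exists (0, 0) => /negP[].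
have nE : n = (n./2).*2 by rewrite even_halfK.
(* The product state has min-entropy 0, which fits whenever $k(n_A-c)=0$. *)
have k_small (c : R) : `|c| <= N0%:R -> (k n)%:R * ((n./2)%:R - c) = 0 ->
    exists (psi_c : vec R (bits 'I_(n./2) * bits 'I_(n./2))%type * R),
    ~~ odd n -> [/\ unit_vec psi_c.1, `|psi_c.2| <= N0%:R,
      Hmin (projector (copies (k n) psi_c.1)) =
        (- ((k n)%:R * ((n./2)%:R - psi_c.2)))%:E &
      ((- ((k n)%:R * (m n./2)%:R))%:E <=
        comp_Hmin G p.[n%:R] (projector (copies (k n) psi_c.1)))%E].
  move=> cN0 c0; exists (diag_state (@zero_weight R 'I_(n./2)), c) => _ /=; split => //.
  - exact: unit_vec_zero_state.
  - by rewrite Hmin_zero_state c0 oppr0.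
  - by apply: comp_Hmin_zero_state; rewrite mulr_ge0.
have [k0|kn0] := posnP (k n); first by apply: (k_small 0); rewrite ?normr0 // k0 mul0r.
have [nN0|N0n] := ltnP n./2 N0.
  (* Below the threshold the error term is all of $n_A$, which is less than [N0]. *)
  by apply: (k_small (n./2)%:R); rewrite ?subrr ?mulr0 // normr_nat ler_nat ltnW.
have [|s sP] := large n./2 N0n; first by rewrite -nE.
exists (diag_state (@phase_weight R 'I_(n./2) s), 0) => _ /=; split.
- exact: unit_vec_phase_state.
- by rewrite normr0.
- by rewrite Hmin_phase_state card_ord subr0.
- by move: sP; rewrite -nE.
Qed.
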